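(* Let $\kappa>3/\pi$ and $\nu\in(0,\infty)$ be real. Then for every $s\in\mathbb{C}$ the function $\eta_{\kappa\nu}$ has the absolutely convergent series expansion $$\eta_{\kappa\nu}(s)=\eta(s)+\sum_{n=1}^{\infty}a_n(\kappa)\,\eta(s+2\nu n),$$ where, for $n$ a non-negative integer, $$a_n(\kappa)=\frac{1}{\tanh\left(\frac{1}{2\kappa}\right)}\sum_{j=n+1}^{\infty}\frac{2^{2n}(2^{2j}-1)B_{2j}}{j\,(2j-2n-1)!\,(2n)!\,\kappa^{2j-1}}$$ and $B_{2j}$ denotes the even Bernoulli numbers ($B_0=1$, $B_2=\frac16$, $B_4=-\frac1{30}$, etc.).
   Context: The Dirichlet eta function is the entire function given for all $s\in\mathbb{C}$ by $\eta(s)=\sum_{k=0}^{\infty}\frac{1}{2^{k+1}}\sum_{m=0}^{k}\binom{k}{m}\frac{(-1)^{m}}{(m+1)^{s}}$ (equal to $\sum_{m\ge1}(-1)^{m-1}m^{-s}$ for $\operatorname{Re}s>0$). For real $x$ and $\kappa\in(0,\infty)$, $$\mathcal{B}_{\kappa}(x):=\frac12\left[\tanh\left(\frac{x+\frac12}{\kappa}\right)-\tanh\left(\frac{x-\frac12}{\kappa}\right)\right].$$ For real $\kappa,\nu\in(0,\infty)$ and $s\in\mathbb{C}$, $$\eta_{\kappa\nu}(s):=\sum_{k=0}^{\infty}\frac{1}{2^{k+1}}\sum_{m=0}^{k}\binom{k}{m}\frac{(-1)^{m}}{(m+1)^{s}}\,\frac{\mathcal{B}_{\kappa}\left(1/(m+1)^{\nu}\right)}{\mathcal{B}_{\kappa}(0)}.$$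 *)

(* Defs.v *)
From Stdlib Require Import Reals Lra Lia Arith.
From Coquelicot Require Import Coquelicot.

Open Scope R_scope.

(** Complex powers and series *)

Definition Cexp (z : C) : C :=
  (exp (Re z) * cos (Im z), exp (Re z) * sin (Im z)).

(* [x ^ s] with the real logarithm, for [0 < x]. *)
Definition Rpow_C (x : R) (s : C) : C := Cexp (s * ln x)%C.

(* Like [Series], this is only meaningful for convergent series: it is then
   the [l] such that [is_series a l], see [CSeries_unique]. *)
Definition CSeries (a : nat -> C) : C :=
  (Series (fun n => Re (a n)), Series (fun n => Im (a n))).

Lemma sum_n_C (a : nat -> C) (n : nat) :
  sum_n a n = (sum_n (fun k => Re (a k)) n, sum_n (fun k => Im (a k)) n).
Proof.
  induction n as [|n IH].
  - rewrite !sum_O. now destruct (a 0%nat).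
  - rewrite !sum_Sn, IH. now destruct (a (S n)).
Qed.

Lemma CSeries_unique (a : nat -> C) (l : C) : is_series a l -> CSeries a = l.
Proof.
  intros H; destruct l as [x y]; unfold CSeries; f_equal; apply is_series_unique.
  - apply filterlim_ext with (fun n => fst (sum_n a n)).
    { intros n; now rewrite sum_n_C. }
    apply filterlim_locally; intros eps.
    generalize (proj1 (filterlim_locally _ _) H eps).
    apply filter_imp; intros n [Hn _]; exact Hn.
  - apply filterlim_ext with (fun n => snd (sum_n a n)).
    { intros n; now rewrite sum_n_C. }
    apply filterlim_locally; intros eps.
    generalize (proj1 (filterlim_locally _ _) H eps).
    apply filter_imp; intros n [_ Hn]; exact Hn.
Qed.

(** Bernoulli numbers *)

(* [bernoulli_upto n] agrees with the Bernoulli numbers on [0 .. n]; the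
   recurrence is [(n+2) B_(n+1) = - \sum_(i <= n) binom(n+2, i) B_i]. *)
Fixpoint bernoulli_upto (n : nat) : nat -> R :=
  match n with
  | O => fun _ => 1
  | S m => fun k =>
      if (k <=? m)%nat then bernoulli_upto m k
      else - / INR (m + 2) *
           sum_n (fun i => Binomial.C (m + 2) i * bernoulli_upto m i) m
  end.

Definition bernoulli (n : nat) : R := bernoulli_upto n n.

Lemma bernoulli_upto_eq (n k : nat) :
  (k <= n)%nat -> bernoulli_upto n k = bernoulli k.
Proof.
  induction n as [|n IH]; intros Hk.
  - now replace k with 0%nat by lia.
  - destruct (Nat.eq_dec k (S n)) as [->|Hne]; [reflexivity|].
    cbn [bernoulli_upto]; rewrite (proj2 (Nat.leb_le k n)) by lia; apply IH; lia.
Qed.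

Lemma bernoulli_0 : bernoulli 0 = 1.
Proof. reflexivity. Qed.

Lemma bernoulli_S (n : nat) :
  bernoulli (S n) =
  - / INR (n + 2) * sum_n (fun i => Binomial.C (n + 2) i * bernoulli i) n.
Proof.
  unfold bernoulli at 1; cbn [bernoulli_upto].
  rewrite (proj2 (Nat.leb_gt (S n) n)) by lia.
  f_equal; apply sum_n_ext_loc; intros i Hi; now rewrite bernoulli_upto_eq.
Qed.

Lemma bernoulli_1 : bernoulli 1 = - / 2.
Proof.
  rewrite bernoulli_S, sum_O, bernoulli_0.
  unfold Binomial.C; simpl; field.
Qed.

Lemma bernoulli_2 : bernoulli 2 = / 6.
Proof.
  rewrite bernoulli_S, sum_Sn, sum_O, bernoulli_0, bernoulli_1.
  unfold Binomial.C, plus; simpl; field.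
Qed.

Lemma bernoulli_3 : bernoulli 3 = 0.
Proof.
  rewrite bernoulli_S, !sum_Sn, sum_O, bernoulli_0, bernoulli_1, bernoulli_2.
  unfold Binomial.C, plus; simpl; field.
Qed.

Lemma bernoulli_4 : bernoulli 4 = - / 30.
Proof.
  rewrite bernoulli_S, !sum_Sn, sum_O.
  rewrite bernoulli_0, bernoulli_1, bernoulli_2, bernoulli_3.
  unfold Binomial.C, plus; simpl; field.
Qed.

(** The eta function and its deformation *)

Definition eta_term (s : C) (k : nat) : C :=
  (RtoC (1 / 2 ^ (k + 1)) *
   sum_n (fun m : nat =>
     RtoC (Binomial.C k m) * (RtoC ((-1) ^ m) / Rpow_C (INR (m + 1)) s)) k)%C.

Definition eta (s : C) : C := CSeries (eta_term s).

Definition calB (kappa x : R) : R :=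
  1 / 2 * (tanh ((x + 1 / 2) / kappa) - tanh ((x - 1 / 2) / kappa)).

Definition eta_kn_term (kappa nu : R) (s : C) (k : nat) : C :=
  (RtoC (1 / 2 ^ (k + 1)) *
   sum_n (fun m : nat =>
     RtoC (Binomial.C k m) * (RtoC ((-1) ^ m) / Rpow_C (INR (m + 1)) s) *
     RtoC (calB kappa (1 / Rpower (INR (m + 1)) nu) / calB kappa 0)) k)%C.

Definition eta_kn (kappa nu : R) (s : C) : C := CSeries (eta_kn_term kappa nu s).

Definition a_term (kappa : R) (n j : nat) : R :=
  2 ^ (2 * n) * (2 ^ (2 * j) - 1) * bernoulli (2 * j) /
  (INR j * INR (fact (2 * j - 2 * n - 1)) * INR (fact (2 * n)) *
   kappa ^ (2 * j - 1)).

(* The sum over [j >= n + 1] is reindexed by [j = n + 1 + i]. *)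
Definition a_coef (kappa : R) (n : nat) : R :=
  1 / tanh (1 / (2 * kappa)) * Series (fun i => a_term kappa n (n + 1 + i)).

(* Main.v *)
Require Import Defs.
From Stdlib Require Import Reals Lra Lia Arith Factorial.
From Coquelicot Require Import Coquelicot.

(** The deformation factor is an even power series [sum_n a_n x ^ (2 n)] in
    [x = (m + 1) ^ (- nu)], with [a_0 = 1]. Substituting it into the Euler transform
    that defines [eta_kn] turns the [n]-th term into the Euler transform at
    [s + 2 nu n], so that the theorem is an exchange of the sums over [n] and over the
    index [k] of the transform. [is_series_swap] is the form of Fubini's theorem
    used for this; it is also used to obtain the [a_n].

    Exchange over [k] and [n]. The inner sum of the Euler transform is the [k]-th finite
    difference at [1] of the function [x ^ (- z)]. If [Re z + p >= 2], then [p] of these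
    differences bring the function down to [O(x ^ -2)] by the mean value theorem
    ([fdiff_cpow_bound]), and the other differences are estimated trivially, because
    [sum_m C(k, m) / (m + 1) ^ 2] is [O(2 ^ k / k ^ 2)]. Hence the transform converges
    absolutely for every [z] ([eta_term_bound]). For [Re z >= 2] one may take [p = 0], and
    the bound no longer depends on [z]; since [s + 2 nu n] eventually lies in that
    half-plane, absolute convergence of the double series follows from that of
    [sum_n a_n].

    Expansion of the factor. It is a difference of two values of [tanh] at
    [(x + 1/2) / kappa] and [(x - 1/2) / kappa], so one expands [tanh] and applies the
    binomial theorem to the odd powers ([odd_power_diff], [a_term_eq]). For
    [0 <= x <= 1] the arguments are at most [3 / (2 kappa)] in absolute value, which is
    less than [PI / 2] exactly when [kappa > 3 / PI].

    The Taylor series of [tanh]. Near [0] its coefficients are identified through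
    the generating function [x / (exp x - 1)] of the Bernoulli numbers
    ([PSeries_tanh_coef_near_0]). That the radius of convergence is at least [PI / 2]
    is seen without complex analysis: [tanh' = 1 - tanh ^ 2] gives a quadratic recursion
    for the coefficients, their absolute values then satisfy the inequality form of the
    recursion for [tan], and a comparison with the differential equation of [tan]
    bounds their partial sums by [tan] ([partial_sum_le_tan]). *)

Open Scope R_scope.

(** * Sums and series *)

(** The sums in normed modules carry operations of canonical structures, which
    [ring] and [field] only recognize after conversion to those of [C] or [R]. *)
Ltac ring_C :=
  change (@plus C_AbelianMonoid) with Cplus;
  match goal with |- ?a = ?b => change (@eq C a b) end; ring.
Ltac to_R :=
  change (@plus R_AbelianMonoid) with Rplus; change (@mult R_Ring) with Rmult;
  match goal with |- ?a = ?b => change (@eq R a b) end.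
Ltac ring_R := to_R; ring.
Ltac field_R := to_R; field.

Lemma sum_n_shift {G : AbelianMonoid} (u : nat -> G) (n : nat) :
  sum_n u (S n) = plus (u O) (sum_n (fun k => u (S k)) n).
Proof.
  induction n as [|n IH].
  - now rewrite sum_Sn, !sum_O.
  - now rewrite sum_Sn, IH, (sum_Sn (fun k => u (S k))), plus_assoc.
Qed.

Lemma sum_n_pairs (u : nat -> R) (m : nat) :
  sum_n u (2 * m + 1) = sum_n (fun n => u (2 * n)%nat + u (2 * n + 1)%nat) m.
Proof.
  induction m as [|m IH].
  - cbn [Nat.mul Nat.add]. rewrite sum_Sn, !sum_O. reflexivity.
  - replace (2 * S m + 1)%nat with (S (S (2 * m + 1))) by lia.
    rewrite 2!sum_Sn, IH, sum_Sn.
    replace (S (2 * m + 1)) with (2 * S m)%nat by lia.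
    replace (2 * S m + 1)%nat with (S (2 * S m)) by lia. ring_R.
Qed.

Lemma sum_n_le (a b : nat -> R) (N : nat) :
  (forall n, (n <= N)%nat -> a n <= b n) -> sum_n a N <= sum_n b N.
Proof.
  induction N as [|N IH]; intros H.
  - rewrite !sum_O. apply H; lia.
  - rewrite !sum_Sn. apply Rplus_le_compat; [apply IH; intros|]; apply H; lia.
Qed.

Lemma sum_n_ge_0 (a : nat -> R) (N : nat) :
  (forall n, (n <= N)%nat -> 0 <= a n) -> 0 <= sum_n a N.
Proof.
  intros H. apply Rle_trans with (sum_n (fun _ => 0) N).
  - rewrite sum_n_const. lra.
  - now apply sum_n_le.
Qed.

Lemma sum_n_norm_le {K : AbsRing} {V : NormedModule K} (f : nat -> V) (N : nat) :
  norm (sum_n f N) <= sum_n (fun n => norm (f n)) N.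
Proof.
  induction N as [|N IH].
  - rewrite !sum_O. apply Rle_refl.
  - rewrite !sum_Sn. eapply Rle_trans; [apply norm_triangle|].
    now apply Rplus_le_compat_r.
Qed.

Lemma is_series_sum_n {K : AbsRing} {V : NormedModule K}
    (f : nat -> nat -> V) (l : nat -> V) (N : nat) :
  (forall n, (n <= N)%nat -> is_series (f n) (l n)) ->
  is_series (fun k => sum_n (fun n => f n k) N) (sum_n l N).
Proof.
  induction N as [|N IH]; intros H.
  - rewrite sum_O. apply is_series_ext with (f 0%nat); [|apply H; lia].
    intros k. now rewrite sum_O.
  - rewrite sum_Sn.
    apply is_series_ext with (fun k => plus (sum_n (fun n => f n k) N) (f (S N) k)).
    { intros k. now rewrite sum_Sn. }
    apply is_series_plus; [apply IH; intros|]; apply H; lia.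
Qed.

Lemma is_series_finite {K : AbsRing} {V : NormedModule K} (f : nat -> V) (N : nat) :
  (forall n, (N < n)%nat -> f n = zero) -> is_series f (sum_n f N).
Proof.
  intros H.
  assert (E : forall d, sum_n f (d + N) = sum_n f N).
  { induction d as [|d IH]; [reflexivity|].
    cbn [Nat.add]. rewrite sum_Sn, IH, H, plus_zero_r by lia. reflexivity. }
  apply filterlim_ext_loc with (fun _ => sum_n f N).
  - exists N. intros n Hn. rewrite <- (E (n - N)%nat). f_equal. lia.
  - apply filterlim_const.
Qed.

Lemma is_series_le_const (a : nat -> R) (l M : R) :
  (forall N, sum_n a N <= M) -> is_series a l -> l <= M.
Proof.
  intros H Ha.
  apply (is_lim_seq_le (sum_n a) (fun _ => M) l M H Ha (is_lim_seq_const M)).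
Qed.

Lemma sum_n_le_is_series (a : nat -> R) (l : R) (N : nat) :
  (forall n, 0 <= a n) -> is_series a l -> sum_n a N <= l.
Proof.
  intros H Ha. apply (is_lim_seq_incr_compare (sum_n a) l Ha).
  intros n. rewrite sum_Sn. unfold plus; simpl. specialize (H (S n)). lra.
Qed.

Lemma is_series_norm_le {K : AbsRing} {V : NormedModule K} (f : nat -> V)
    (l : V) (a : nat -> R) (M : R) :
  (forall n, norm (f n) <= a n) -> is_series f l -> is_series a M -> norm l <= M.
Proof.
  intros H Hf Ha.
  apply (is_lim_seq_le (fun N => norm (sum_n f N)) (sum_n a) (norm l) M); [| |exact Ha].
  - intros N. eapply Rle_trans; [apply sum_n_norm_le|]. apply sum_n_le; auto.
  - apply (filterlim_comp _ _ _ (sum_n f) norm _ _ _ Hf). apply filterlim_norm.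
Qed.

Lemma minus_plus_r {G : AbelianGroup} (x y : G) : plus (minus x y) y = x.
Proof.
  unfold minus. now rewrite <- plus_assoc, plus_opp_l, plus_zero_r.
Qed.

Lemma is_series_tail {K : AbsRing} {V : NormedModule K} (f : nat -> V) (l : V) (N : nat) :
  is_series f l -> is_series (fun k => f (S N + k)%nat) (minus l (sum_n f N)).
Proof.
  intros Hf. apply is_series_incr_n; [lia|].
  cbn [Init.Nat.pred].
  exact (eq_ind_r (is_series f) Hf (minus_plus_r (G := NormedModule.AbelianGroup K V) l _)).
Qed.

Lemma is_series_tail_norm_le {K : AbsRing} {V : NormedModule K} (f : nat -> V)
    (l : V) (L : R) (N : nat) :
  is_series f l -> is_series (fun n => norm (f n)) L ->
  norm (minus l (sum_n f N)) <= L - sum_n (fun n => norm (f n)) N.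
Proof.
  intros Hf HL.
  apply (is_series_norm_le (fun k => f (S N + k)%nat) _ (fun k => norm (f (S N + k)%nat))).
  - intros n. apply Rle_refl.
  - now apply is_series_tail.
  - exact (is_series_tail (V := R_NormedModule) _ L N HL).
Qed.

Lemma is_series_single (k : nat) (x : R) :
  is_series (fun n => if (n =? k)%nat then x else 0) x.
Proof.
  set (f := fun n => if (n =? k)%nat then x else 0). change (is_series f x).
  assert (E : sum_n f k = x).
  { unfold f. destruct k as [|k]; [now rewrite sum_O|].
    rewrite sum_Sn, Nat.eqb_refl, (sum_n_ext_loc _ (fun _ => 0)).
    - rewrite sum_n_const. ring_R.
    - intros n Hn. destruct (Nat.eqb_spec n (S k)); [lia|reflexivity]. }
  apply (eq_ind _ (is_series f)) with (2 := E).
  apply (is_series_finite (V := R_NormedModule)).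
  intros n Hn. unfold f. destruct (Nat.eqb_spec n k); [lia|reflexivity].
Qed.

Lemma is_series_odd (a : nat -> R) (l : R) :
  (forall n, a (2 * n)%nat = 0) -> is_series a l -> is_series (fun n => a (2 * n + 1)%nat) l.
Proof.
  intros H0 Ha.
  apply filterlim_ext with (fun n => sum_n a (2 * n + 1)).
  - intros n. induction n as [|n IH].
    + cbn [Nat.mul Nat.add]. rewrite sum_Sn, !sum_O, (H0 O : a O = 0).
      apply Rplus_0_l.
    + replace (2 * S n + 1)%nat with (S (S (2 * n + 1))) by lia.
      rewrite 2!sum_Sn, IH, sum_Sn. replace (S (2 * n + 1)) with (2 * S n)%nat by lia.
      rewrite H0. replace (2 * S n + 1)%nat with (S (2 * S n)) by lia. f_equal. apply Rplus_0_r.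
  - apply (filterlim_comp _ _ _ (fun n => (2 * n + 1)%nat) (sum_n a) _ eventually); [|exact Ha].
    intros P [N HN]. exists N. intros n Hn. apply HN. lia.
Qed.

Lemma is_series_RtoC (a : nat -> R) (l : R) :
  is_series a l -> is_series (fun n => RtoC (a n)) (RtoC l).
Proof.
  intros H.
  assert (E : forall n, sum_n (fun n => RtoC (a n)) n = RtoC (sum_n a n)).
  { induction n as [|n IH]; [now rewrite !sum_O|].
    rewrite !sum_Sn, IH. change (@plus R_AbelianMonoid) with Rplus.
    now rewrite RtoC_plus. }
  apply (filterlim_locally_ball_norm (U := C_NormedModule)). intros eps.
  assert (H' : is_lim_seq (sum_n a) l) by exact H.
  apply is_lim_seq_spec in H'. destruct (H' eps) as [N HN].
  exists N. intros n Hn. rewrite E.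
  change (Cmod (RtoC (sum_n a n) - RtoC l)%C < eps).
  rewrite <- RtoC_minus, Cmod_R. now apply HN.
Qed.

(** * Interchanging the order of summation *)

(** Both iterated sums are the supremum of the sums over finite rectangles. *)
Lemma is_series_swap_nonneg (a : nat -> nat -> R) (col row : nat -> R) (S : R) :
  (forall n k, 0 <= a n k) ->
  (forall k, is_series (fun n => a n k) (col k)) ->
  (forall n, is_series (a n) (row n)) ->
  is_series col S -> is_series row S.
Proof.
  intros Ha Hc Hr HS.
  assert (Hc0 : forall k, 0 <= col k).
  { intros k. eapply Rle_trans; [|apply (sum_n_le_is_series _ _ 0 (fun n => Ha n k) (Hc k))].
    rewrite sum_O. apply Ha. }
  assert (Hup : forall N, sum_n row N <= S).
  { intros N. apply (is_series_le_const (fun k => sum_n (fun n => a n k) N)).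
    - intros K. apply Rle_trans with (sum_n col K).
      + apply sum_n_le. intros k _. apply sum_n_le_is_series; [intros n; apply Ha|apply Hc].
      + now apply sum_n_le_is_series.
    - exact (is_series_sum_n (V := R_NormedModule) a row N (fun n _ => Hr n)). }
  enough (E : is_lim_seq (sum_n row) S) by exact E.
  apply is_lim_seq_spec. intros eps.
  assert (HS' : is_lim_seq (sum_n col) S) by exact HS.
  apply is_lim_seq_spec in HS'. destruct (HS' (pos_div_2 eps)) as [K HK].
  specialize (HK K (le_n K)). simpl in HK. apply Rabs_def2 in HK.
  assert (HN : is_lim_seq (sum_n (fun n => sum_n (fun k => a n k) K)) (sum_n col K)).
  { exact (is_series_sum_n (V := R_NormedModule) (fun k n => a n k) col K (fun k _ => Hc k)). }
  apply is_lim_seq_spec in HN. destruct (HN (pos_div_2 eps)) as [N0 HN0].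
  exists N0. intros N HN1. specialize (HN0 N HN1). simpl in HN0.
  apply Rabs_def2 in HN0.
  assert (sum_n (fun n => sum_n (fun k => a n k) K) N <= sum_n row N).
  { apply sum_n_le. intros n _. apply sum_n_le_is_series; auto. }
  specialize (Hup N). apply Rabs_def1; lra.
Qed.

(** The error of the partial sum over [n <= N] is at most that of the same
    partial sum for the norms, which tends to [0] by the nonnegative case. *)
Lemma is_series_swap {K : AbsRing} {V : CompleteNormedModule K}
    (f : nat -> nat -> V) (h : nat -> R) (col row : nat -> V) (S : V) :
  (forall k, is_series (fun n => norm (f n k)) (h k)) -> ex_series h ->
  (forall k, is_series (fun n => f n k) (col k)) ->
  (forall n, is_series (f n) (row n)) ->
  is_series col S -> is_series row S /\ ex_series (fun n => norm (row n)).
Proof.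
  intros Hh [H HH] Hc Hr HS.
  assert (Hle : forall n k, norm (f n k) <= h k).
  { intros n k. eapply Rle_trans;
      [|apply (sum_n_le_is_series _ _ n (fun n => norm_ge_0 _) (Hh k))].
    destruct n; [rewrite sum_O; apply Rle_refl|]. rewrite sum_Sn.
    assert (0 <= sum_n (fun n => norm (f n k)) n)
      by (apply sum_n_ge_0; intros; apply norm_ge_0).
    unfold plus; simpl; lra. }
  assert (Hex : forall n, ex_series (fun k => norm (f n k))).
  { intros n. apply (ex_series_le (V := R_CompleteNormedModule) _ h); [|now exists H].
    intros k. unfold norm at 1; simpl. unfold abs; simpl.
    rewrite Rabs_pos_eq by apply norm_ge_0. apply Hle. }
  set (rho := fun n => Series (fun k => norm (f n k))).
  assert (HR : forall n, is_series (fun k => norm (f n k)) (rho n))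
    by (intros n; now apply Series_correct).
  assert (HRH : is_series rho H).
  { apply (is_series_swap_nonneg (fun n k => norm (f n k)) h); auto.
    intros; apply norm_ge_0. }
  assert (Hrow : forall n, norm (row n) <= rho n).
  { intros n. apply (is_series_norm_le (f n) _ (fun k => norm (f n k))); auto.
    intros; apply Rle_refl. }
  assert (Herr : forall N, norm (minus (sum_n row N) S) <= H - sum_n rho N).
  { intros N. rewrite <- norm_opp, opp_minus.
    apply (is_series_norm_le (fun k => minus (col k) (sum_n (fun n => f n k) N)) _
             (fun k => h k - sum_n (fun n => norm (f n k)) N)).
    - intros k. exact (is_series_tail_norm_le _ _ _ N (Hc k) (Hh k)).
    - exact (is_series_minus (V := V) col (fun k => sum_n (fun n => f n k) N) S (sum_n row N)
               HS (is_series_sum_n f row N (fun n _ => Hr n))).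
    - exact (is_series_minus (V := R_NormedModule)
               h (fun k => sum_n (fun n => norm (f n k)) N) H (sum_n rho N)
               HH (is_series_sum_n (V := R_NormedModule)
                     (fun n k => norm (f n k)) rho N (fun n _ => HR n))). }
  split.
  - apply filterlim_locally_ball_norm. intros eps.
    assert (HL : is_lim_seq (sum_n rho) H) by exact HRH.
    apply is_lim_seq_spec in HL. destruct (HL eps) as [N0 HN0].
    exists N0. intros N HN. specialize (HN0 N HN). apply Rabs_def2 in HN0.
    eapply Rle_lt_trans; [exact (Herr N)|]. simpl in HN0; lra.
  - apply (ex_series_le (V := R_CompleteNormedModule) _ rho); [|now exists H].
    intros n. unfold norm at 1; simpl. unfold abs; simpl.
    rewrite Rabs_pos_eq by apply norm_ge_0. apply Hrow.
Qed.

(** * Finite differences *)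

Fixpoint fdiff (p : nat) (f : R -> C) (x : R) : C :=
  match p with
  | O => f x
  | S p => fdiff p (fun y => f y - f (y + 1)%R)%C x
  end.

Lemma fdiff_add (p q : nat) (f : R -> C) (x : R) :
  fdiff (p + q) f x = fdiff q (fdiff p f) x.
Proof.
  revert f; induction p as [|p IH]; intros f; [reflexivity|apply IH].
Qed.

Lemma fdiff_sum (p : nat) (f : R -> C) (x : R) :
  fdiff p f x =
  sum_n (fun m => RtoC (Binomial.C p m) * RtoC ((-1) ^ m) * f (x + INR m)%R)%C p.
Proof.
  revert f; induction p as [|p IH]; intros f.
  - rewrite sum_O. simpl. rewrite C_n_0, Rplus_0_r. now rewrite !Cmult_1_l.
  - change (fdiff (S p) f x) with (fdiff p (fun y => f y - f (y + 1)%R)%C x).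
    rewrite IH.
    set (g := fun m => (RtoC ((-1) ^ m) * f (x + INR m)%R)%C).
    transitivity (sum_n (fun m => plus (RtoC (Binomial.C p m) * g m)%C
                                       (RtoC (Binomial.C p m) * g (S m))%C) p).
    { apply sum_n_ext. intros m. unfold g. rewrite S_INR. cbn [pow].
      replace (x + (INR m + 1)) with (x + INR m + 1) by ring.
      replace (-1 * (-1) ^ m) with (- (-1) ^ m) by ring.
      rewrite RtoC_opp. ring_C. }
    transitivity (sum_n (fun m => (RtoC (Binomial.C (S p) m) * g m)%C) (S p)).
    2: { apply sum_n_ext. intros m. unfold g. ring_C. }
    rewrite sum_n_plus.
    destruct p as [|p].
    + rewrite sum_Sn, !sum_O, !C_n_0, C_n_n. reflexivity.
    + rewrite (sum_n_shift _ (S p)), (sum_n_shift (fun m => (RtoC (Binomial.C (S p) m) * g m)%C)).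
      rewrite !(sum_Sn _ p), !C_n_0, !C_n_n.
      rewrite (sum_n_ext_loc (fun k => RtoC (Binomial.C (S (S p)) (S k)) * g (S k))%C
                 (fun k => plus (RtoC (Binomial.C (S p) k) * g (S k))%C
                             (RtoC (Binomial.C (S p) (S k)) * g (S k))%C)).
      2: { intros k Hk. rewrite <- pascal by lia. rewrite RtoC_plus. ring_C. }
      rewrite sum_n_plus. ring_C.
Qed.

(** The mean value theorem, iterated; as it fails for complex-valued functions, it is
    applied to the real part of [c] times the function, for an arbitrary [c]. *)
Lemma fdiff_mvt (p : nat) (F : nat -> R -> C) (c : C) (x : R) :
  (forall i y, x <= y ->
     is_derive (fun t => Re (c * F i t)%C) y (Re (c * F (S i) y)%C)) ->
  exists y, x <= y /\ Rabs (Re (c * fdiff p (F O) x)%C) = Rabs (Re (c * F p y)%C).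
Proof.
  revert F; induction p as [|p IH]; intros F HF.
  - exists x. split; [lra|reflexivity].
  - destruct (IH (fun i y => F i y - F i (y + 1)%R)%C) as [y [Hy E]].
    { intros i y Hy.
      apply is_derive_ext with (fun t => minus (Re (c * F i t)%C) (Re (c * F i (t + 1)%R)%C)).
      { intros t. unfold minus, plus, opp; simpl. ring. }
      replace (Re (c * (F (S i) y - F (S i) (y + 1)%R))%C)
        with (minus (Re (c * F (S i) y)%C) (scal 1 (Re (c * F (S i) (y + 1)%R)%C)))
        by (unfold minus, plus, opp, scal, mult; simpl; unfold mult; simpl; ring).
      apply (is_derive_minus (V := R_NormedModule)); [now apply HF|].
      apply (is_derive_comp (fun t => Re (c * F i t)%C) (fun t => t + 1)).
      - apply HF; lra.
      - auto_derive; auto. }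
    destruct (MVT_gen (fun t => Re (c * F p t)%C) y (y + 1)
                (fun t => Re (c * F (S p) t)%C)) as [z [Hz E']].
    { intros t Ht. apply HF. rewrite Rmin_left in Ht; lra. }
    { intros t Ht. apply derivable_continuous_pt.
      exists (Re (c * F (S p) t)%C). apply is_derive_Reals, HF.
      rewrite Rmin_left in Ht; lra. }
    rewrite Rmin_left in Hz by lra.
    exists z. split; [lra|].
    change (fdiff (S p) (F O) x) with (fdiff p (fun y => F O y - F O (y + 1)%R)%C x).
    rewrite E.
    replace (Re (c * (F p y - F p (y + 1)%R))%C)
      with (- (Re (c * F p (y + 1)%R)%C - Re (c * F p y)%C)) by (simpl; ring).
    rewrite E', Rabs_Ropp. f_equal. ring.
Qed.

(** * The Euler transform of the eta series *)

Lemma Cmod_Cexp (z : C) : Cmod (Cexp z) = exp (Re z).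
Proof.
  unfold Cexp, Cmod. simpl fst; simpl snd.
  replace ((exp (Re z) * cos (Im z)) ^ 2 + (exp (Re z) * sin (Im z)) ^ 2)
    with (exp (Re z) ^ 2).
  - apply sqrt_pow2, Rlt_le, exp_pos.
  - generalize (sin2_cos2 (Im z)). unfold Rsqr. intros H.
    transitivity (exp (Re z) ^ 2 * (sin (Im z) * sin (Im z) + cos (Im z) * cos (Im z))).
    + rewrite H; ring.
    + ring.
Qed.

Lemma Cexp_plus (z w : C) : Cexp (z + w)%C = (Cexp z * Cexp w)%C.
Proof.
  unfold Cexp; simpl. rewrite exp_plus, cos_plus, sin_plus.
  unfold Cmult; simpl. f_equal; unfold Re, Im; ring.
Qed.

Lemma Cexp_RtoC (x : R) : Cexp (RtoC x) = RtoC (exp x).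
Proof.
  unfold Cexp, RtoC; simpl. rewrite cos_0, sin_0. f_equal; ring.
Qed.

Lemma Cexp_neq_0 (z : C) : Cexp z <> 0.
Proof.
  apply Cmod_gt_0. rewrite Cmod_Cexp. apply exp_pos.
Qed.

Lemma Cexp_opp (z : C) : Cexp (- z)%C = (/ Cexp z)%C.
Proof.
  assert (E : (Cexp z * Cexp (- z) = 1)%C).
  { rewrite <- Cexp_plus. replace (z + - z)%C with (RtoC 0) by ring.
    now rewrite Cexp_RtoC, exp_0. }
  replace (Cexp (- z)) with (/ Cexp z * (Cexp z * Cexp (- z)))%C.
  - rewrite E. ring.
  - field. apply Cexp_neq_0.
Qed.

Fixpoint falling (w : C) (i : nat) : C :=
  match i with
  | O => 1%C
  | S i => (falling w i * (w - RtoC (INR i)))%C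
  end.

(** The [i]-th derivative of [x ^ w]. *)
Definition cpow_deriv (w : C) (i : nat) (x : R) : C :=
  (falling w i * Cexp ((w - RtoC (INR i)) * RtoC (ln x)))%C.

Lemma is_derive_cpow (c w : C) (x : R) :
  0 < x ->
  is_derive (fun t => Re (c * Cexp (w * RtoC (ln t)))%C) x
    (Re (c * (w * Cexp ((w - 1) * RtoC (ln x))))%C).
Proof.
  intros Hx. destruct c as [c1 c2], w as [a b].
  replace (Cexp (((a, b) - 1) * RtoC (ln x)))%C
    with (Cexp ((a, b) * RtoC (ln x)) * RtoC (/ x))%C.
  2: { rewrite <- (exp_ln (/ x)) by now apply Rinv_0_lt_compat.
       rewrite <- Cexp_RtoC, <- Cexp_plus, ln_Rinv, RtoC_opp by assumption.
       f_equal. ring. }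
  unfold Cexp; simpl.
  auto_derive; [repeat split; assumption|].
  unfold Rminus. ring.
Qed.

Lemma is_derive_cpow_deriv (c w : C) (i : nat) (x : R) :
  0 < x ->
  is_derive (fun t => Re (c * cpow_deriv w i t)%C) x (Re (c * cpow_deriv w (S i) x)%C).
Proof.
  intros Hx.
  apply is_derive_ext
    with (fun t => Re ((c * falling w i) * Cexp ((w - RtoC (INR i)) * RtoC (ln t)))%C).
  { intros t. unfold cpow_deriv. now rewrite Cmult_assoc. }
  replace (c * cpow_deriv w (S i) x)%C
    with ((c * falling w i) * ((w - RtoC (INR i)) *
            Cexp ((w - RtoC (INR i) - 1) * RtoC (ln x))))%C.
  - now apply is_derive_cpow.
  - unfold cpow_deriv; cbn [falling]. rewrite S_INR, RtoC_plus.
    replace (w - (RtoC (INR i) + 1))%C with (w - RtoC (INR i) - 1)%C by ring.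
    ring.
Qed.

(** Take [c] to be the conjugate of [z]. *)
Lemma Cmod_le_of_Re (z : C) (M : R) :
  0 <= M -> (forall c, Rabs (Re (c * z)%C) <= Cmod c * M) -> Cmod z <= M.
Proof.
  intros HM H.
  destruct (Req_dec (Cmod z) 0) as [E|E]; [now rewrite E|].
  assert (Hpos : 0 < Cmod z) by (generalize (Cmod_ge_0 z); lra).
  specialize (H (Cconj z)). rewrite Cmod_conj in H.
  apply Rmult_le_reg_l with (Cmod z); [assumption|].
  eapply Rle_trans; [|exact H].
  replace (Re (Cconj z * z)%C) with (Cmod z ^ 2).
  - rewrite Rabs_pos_eq; [lra|apply pow2_ge_0].
  - rewrite Cmod2_alt. destruct z as [a b]. simpl. ring.
Qed.

Lemma exp_le (x y : R) : x <= y -> exp x <= exp y.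
Proof.
  intros [H| ->]; [now apply Rlt_le, exp_increasing|apply Rle_refl].
Qed.

(** By the mean value theorem the [p]-th difference is controlled by the [p]-th
    derivative, which has gained a factor [x ^ p] of decay. *)
Lemma fdiff_cpow_bound (p : nat) (w : C) (x : R) :
  1 <= x -> Re w - INR p <= -2 ->
  Cmod (fdiff p (fun y => Cexp (w * RtoC (ln y))) x) <=
  Cmod (falling w p) * / x ^ 2.
Proof.
  intros Hx Hw.
  assert (Hx2 : 0 < x ^ 2) by (apply pow_lt; lra).
  apply Cmod_le_of_Re.
  { apply Rmult_le_pos; [apply Cmod_ge_0|now apply Rlt_le, Rinv_0_lt_compat]. }
  intros c.
  destruct (fdiff_mvt p (cpow_deriv w) c x) as [y [Hy E]].
  { intros i y Hy. apply is_derive_cpow_deriv. lra. }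
  replace (fdiff p (fun y => Cexp (w * RtoC (ln y))) x) with (fdiff p (cpow_deriv w 0) x).
  2: { rewrite !fdiff_sum. apply sum_n_ext. intros m. unfold cpow_deriv; simpl.
       replace (w - 0)%C with w by ring. now rewrite Cmult_1_l. }
  rewrite E. eapply Rle_trans; [apply re_le_Cmod|].
  unfold cpow_deriv. rewrite !Cmod_mult, Cmod_Cexp.
  apply Rmult_le_compat_l; [apply Cmod_ge_0|].
  apply Rmult_le_compat_l; [apply Cmod_ge_0|].
  replace (Re ((w - RtoC (INR p)) * RtoC (ln y))%C) with ((Re w - INR p) * ln y)
    by (destruct w; simpl; ring).
  assert (0 <= ln x) by (rewrite <- ln_1; apply ln_le; lra).
  assert (ln x <= ln y) by (apply ln_le; lra).
  rewrite <- (exp_ln (x ^ 2)) by assumption. rewrite <- exp_Ropp.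
  apply exp_le. rewrite ln_pow by lra. simpl INR.
  nra.
Qed.

Lemma binom_nonneg (n k : nat) : 0 <= Binomial.C n k.
Proof.
  unfold Binomial.C. apply Rdiv_le_0_compat; [apply pos_INR|].
  apply Rmult_lt_0_compat; apply INR_fact_lt_0.
Qed.

Lemma sum_binom (n : nat) : sum_n (Binomial.C n) n = 2 ^ n.
Proof.
  replace 2 with (1 + 1) by ring. rewrite binomial, sum_n_Reals.
  apply sum_eq. intros i _. rewrite !pow1. ring.
Qed.

(** From [C(k, m) / ((m + 1) (m + 2)) = C(k + 2, m + 2) / ((k + 1) (k + 2))], whose
    numerators add up to at most [2 ^ (k + 2)]. *)
Lemma sum_binom_div_le (k : nat) :
  sum_n (fun m => Binomial.C k m * / (INR m + 1) ^ 2) k <=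
  2 * 2 ^ (k + 2) / ((INR k + 1) * (INR k + 2)).
Proof.
  assert (Hpos : forall n, 0 <= INR n) by apply pos_INR.
  assert (Hk := Hpos k).
  set (A := 2 / ((INR k + 1) * (INR k + 2))).
  assert (HA : 0 <= A) by (apply Rdiv_le_0_compat; nra).
  apply Rle_trans with (A * sum_n (fun m => Binomial.C (S (S k)) (S (S m))) k).
  - rewrite <- (sum_n_mult_l (K := R_Ring)). apply sum_n_le. intros m Hm.
    change (@mult R_Ring) with Rmult. assert (Hm0 := Hpos m).
    replace (A * Binomial.C (S (S k)) (S (S m)))
      with (Binomial.C k m * (2 / ((INR m + 1) * (INR m + 2)))).
    + apply Rmult_le_compat_l; [apply binom_nonneg|].
      replace (/ (INR m + 1) ^ 2)
        with ((INR m + 2) / (INR m + 1) * / ((INR m + 1) * (INR m + 2))) by (field; lra).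
      apply Rmult_le_compat_r.
      * apply Rlt_le, Rinv_0_lt_compat; nra.
      * apply Rle_div_l; lra.
    + unfold A, Binomial.C. replace (S (S k) - S (S m))%nat with (k - m)%nat by lia.
      rewrite !fact_simpl, !mult_INR, !S_INR. field.
      repeat split; try apply INR_fact_neq_0; lra.
  - rewrite <- (sum_binom (k + 2)). unfold A.
    replace (k + 2)%nat with (S (S k)) by lia.
    rewrite (sum_n_shift _ (S k)), (sum_n_shift _ k).
    assert (H1 := binom_nonneg (S (S k)) 0). assert (H2 := binom_nonneg (S (S k)) 1).
    change (@plus R_AbelianMonoid) with Rplus. fold A.
    replace (2 * _ / _) with (A * (Binomial.C (S (S k)) 0 + (Binomial.C (S (S k)) 1 +
       sum_n (fun k0 => Binomial.C (S (S k)) (S (S k0))) k))).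
    + nra.
    + unfold A. field. lra.
Qed.

Lemma is_series_telescope : is_series (fun k => / ((INR k + 1) * (INR k + 2))) 1.
Proof.
  enough (H : is_lim_seq (sum_n (fun k => / ((INR k + 1) * (INR k + 2)))) 1) by exact H.
  apply is_lim_seq_ext with (fun n => 1 - / (INR n + 2)).
  - intros n. induction n as [|n IH].
    + rewrite sum_O. simpl. field.
    + rewrite sum_Sn, <- IH, S_INR. change (@plus R_AbelianMonoid) with Rplus.
      assert (H := pos_INR n). field. lra.
  - replace (Finite 1) with (Finite (1 - 0)) by (f_equal; ring).
    apply is_lim_seq_minus'; [apply is_lim_seq_const|].
    apply (is_lim_seq_inv (fun n => INR n + 2) p_infty); [|discriminate].
    apply is_lim_seq_plus with p_infty 2; [apply is_lim_seq_INR|apply is_lim_seq_const|].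
    reflexivity.
Qed.

Lemma Rpow_C_cpow (x : R) (z : C) :
  Rpow_C x z = (/ Cexp (- z * RtoC (ln x)))%C.
Proof.
  unfold Rpow_C. rewrite <- Cexp_opp. f_equal. ring.
Qed.

Lemma eta_term_fdiff (z : C) (k : nat) :
  eta_term z k =
  (RtoC (1 / 2 ^ (k + 1)) * fdiff k (fun y => Cexp (- z * RtoC (ln y))) 1)%C.
Proof.
  unfold eta_term. f_equal. rewrite fdiff_sum. apply sum_n_ext. intros m.
  rewrite Rpow_C_cpow. replace (INR (m + 1)) with (1 + INR m) by (rewrite plus_INR; simpl; ring).
  assert (H := Cexp_neq_0 (- z * RtoC (ln (1 + INR m)))).
  match goal with |- ?a = ?b => change (@eq C a b) end.
  field. exact H.
Qed.

(** Of the [p + k] differences, [p] provide the decay of the summand and the other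
    [k] are estimated by the triangle inequality. *)
Lemma eta_term_bound (p k : nat) (z : C) :
  2 <= Re z + INR p ->
  Cmod (eta_term z (p + k)) <=
  Cmod (falling (- z) p) * (4 * / ((INR k + 1) * (INR k + 2))).
Proof.
  intros Hz. rewrite eta_term_fdiff, Cmod_mult, Cmod_R, fdiff_add, fdiff_sum.
  assert (H2 : forall n, 0 < 2 ^ n) by (intros; apply pow_lt; lra).
  assert (Hk := pos_INR k).
  set (M := Cmod (falling (- z) p)).
  assert (HM : 0 <= M) by apply Cmod_ge_0.
  rewrite Rabs_pos_eq by (apply Rdiv_le_0_compat; [lra|apply H2]).
  apply Rle_trans with (1 / 2 ^ (p + k + 1) *
    (M * (2 * 2 ^ (k + 2) / ((INR k + 1) * (INR k + 2))))).
  - apply Rmult_le_compat_l; [apply Rdiv_le_0_compat; [lra|apply H2]|].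
    eapply Rle_trans; [apply (sum_n_norm_le (V := C_NormedModule))|].
    apply Rle_trans with (M * sum_n (fun m => Binomial.C k m * / (INR m + 1) ^ 2) k).
    + rewrite <- (sum_n_mult_l (K := R_Ring)). apply sum_n_le. intros m Hm.
      change (@norm C_AbsRing C_NormedModule) with Cmod.
      rewrite !Cmod_mult, !Cmod_R, <- RPow_abs.
      replace (Rabs (-1)) with 1 by (rewrite Rabs_left; lra).
      rewrite pow1, Rmult_1_r, (Rabs_pos_eq (Binomial.C k m)) by apply binom_nonneg.
      change (@mult R_Ring) with Rmult.
      rewrite <- Rmult_assoc, (Rmult_comm M), Rmult_assoc.
      apply Rmult_le_compat_l; [apply binom_nonneg|].
      rewrite (Rplus_comm (INR m)). apply fdiff_cpow_bound.
      * generalize (pos_INR m); lra.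
      * destruct z; simpl in *; lra.
    + apply Rmult_le_compat_l; [assumption|]. apply sum_binom_div_le.
  - replace (p + k + 1)%nat with (p + (k + 1))%nat by lia.
    rewrite !pow_add.
    replace (1 / (2 ^ p * (2 ^ k * 2 ^ 1)) *
      (M * (2 * (2 ^ k * 2 ^ 2) / ((INR k + 1) * (INR k + 2)))))
      with (/ 2 ^ p * (M * (4 * / ((INR k + 1) * (INR k + 2))))).
    2: { specialize (H2 k) as H3. specialize (H2 p) as H4. field. lra. }
    assert (/ 2 ^ p <= 1).
    { rewrite <- Rinv_1. apply Rinv_le_contravar; [lra|]. apply pow_R1_Rle; lra. }
    rewrite <- (Rmult_1_l (M * _)) at 2.
    apply Rmult_le_compat_r; [|assumption].
    apply Rmult_le_pos; [assumption|]. apply Rmult_le_pos; [lra|].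
    apply Rlt_le, Rinv_0_lt_compat; nra.
Qed.

Lemma ex_series_norm_eta_term (z : C) : ex_series (fun k => Cmod (eta_term z k)).
Proof.
  destruct (nfloor_ex (Rmax 0 (2 - Re z))) as [p [_ Hp]]; [apply Rmax_l|].
  apply (ex_series_incr_n _ (S p)).
  apply (ex_series_le (V := R_CompleteNormedModule) _
           (fun k => Cmod (falling (- z) (S p)) * (4 * / ((INR k + 1) * (INR k + 2))))).
  - intros k. unfold norm; simpl norm. change (@abs R_AbsRing) with Rabs.
    rewrite Rabs_pos_eq by apply Cmod_ge_0.
    apply eta_term_bound. rewrite S_INR.
    generalize (Rmax_r 0 (2 - Re z)). lra.
  - apply (ex_series_scal_l (V := R_NormedModule)), (ex_series_scal_l (V := R_NormedModule)).
    exists 1. apply is_series_telescope.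
Qed.

Lemma ex_series_eta_term (z : C) : ex_series (eta_term z).
Proof.
  apply (ex_series_le (V := C_CompleteNormedModule) _ (fun k => Cmod (eta_term z k))).
  - intros n. apply Rle_refl.
  - apply ex_series_norm_eta_term.
Qed.

(** The case [p = 0] of [eta_term_bound], where the constant no longer depends on
    [z]: this uniformity is what allows [z] to run through [s + 2 nu n]. *)
Lemma norm_eta_term_le (z : C) :
  2 <= Re z -> Series (fun k => Cmod (eta_term z k)) <= 4.
Proof.
  intros Hz.
  assert (E : is_series (fun k => 4 * / ((INR k + 1) * (INR k + 2))) (4 * 1))
    by (apply (is_series_scal_l (V := R_NormedModule)), is_series_telescope).
  rewrite <- (Rmult_1_r 4), <- (is_series_unique _ _ E).
  apply Series_le; [|now exists (4 * 1)].
  intros k. split; [apply Cmod_ge_0|].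
  generalize (eta_term_bound 0 k z). simpl.
  rewrite Cmod_1, Rmult_1_l, Rplus_0_r. auto.
Qed.

(** * The Taylor series of the hyperbolic tangent *)

Lemma CV_radius_ge (a : nat -> R) (r M : R) :
  (forall n, Rabs (a n * r ^ n) <= M) -> Rbar_le r (CV_radius a).
Proof.
  intros H. apply (CV_radius_bounded a). now exists M.
Qed.

Definition bernoulli_egf (n : nat) : R := bernoulli n / INR (fact n).

Lemma bernoulli_egf_S (n : nat) :
  bernoulli_egf (S n) =
  - sum_n (fun i => bernoulli_egf i * / INR (fact (n + 2 - i))) n.
Proof.
  unfold bernoulli_egf at 1. rewrite bernoulli_S.
  assert (Hn := pos_INR n).
  replace (n + 2)%nat with (S (S n)) by lia.
  transitivity (- (/ INR (fact (S (S n))) *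
     sum_n (fun i => Binomial.C (S (S n)) i * bernoulli i) n)).
  - rewrite (fact_simpl (S n)), mult_INR, !S_INR. field.
    split; [apply INR_fact_neq_0|lra].
  - f_equal. rewrite <- (sum_n_mult_l (K := R_Ring)). apply sum_n_ext_loc. intros i Hi.
    change (@mult R_Ring) with Rmult. unfold bernoulli_egf, Binomial.C.
    field_R. repeat split; apply INR_fact_neq_0.
Qed.

Lemma inv_fact_le (n : nat) : / INR (fact (S n)) <= (/ 2) ^ n.
Proof.
  induction n as [|n IH]; [simpl; lra|].
  rewrite fact_simpl, mult_INR, Rinv_mult. cbn [pow].
  assert (0 < INR (fact (S n))) by apply INR_fact_lt_0.
  apply Rmult_le_compat; auto; try apply Rlt_le, Rinv_0_lt_compat; auto.
  - apply lt_0_INR; lia.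
  - apply Rinv_le_contravar; [lra|]. rewrite !S_INR. generalize (pos_INR n). lra.
Qed.

Lemma sum_half_le (n : nat) : sum_n (fun i => (/ 2) ^ (S n - i)) n <= 1.
Proof.
  enough (E : sum_n (fun i => (/ 2) ^ (S n - i)) n = 1 - (/ 2) ^ S n).
  { rewrite E. assert (0 < (/ 2) ^ S n) by (apply pow_lt; lra). lra. }
  induction n as [|n IH].
  - rewrite sum_O. simpl. lra.
  - rewrite sum_Sn.
    replace (sum_n _ n) with (/ 2 * (1 - (/ 2) ^ S n)).
    2: { rewrite <- IH, <- (sum_n_mult_l (K := R_Ring)). apply sum_n_ext_loc. intros i Hi.
         replace (S (S n) - i)%nat with (S (S n - i)) by lia. reflexivity. }
    replace (S (S n) - S n)%nat with 1%nat by lia.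
    cbn [pow]. field_R.
Qed.

(** The tail of the exponential series in the recursion is at most
    [1/2 + 1/4 + ... <= 1]; this crude bound gives a positive radius of convergence. *)
Lemma bernoulli_egf_bound (n : nat) : Rabs (bernoulli_egf n) <= 1.
Proof.
  induction n as [n IH] using lt_wf_ind. destruct n as [|n].
  - unfold bernoulli_egf. rewrite bernoulli_0. simpl. rewrite Rabs_pos_eq; lra.
  - rewrite bernoulli_egf_S, Rabs_Ropp.
    eapply Rle_trans; [apply (sum_n_norm_le (V := R_NormedModule))|].
    eapply Rle_trans; [|apply (sum_half_le n)].
    apply sum_n_le. intros i Hi.
    change (@norm R_AbsRing R_NormedModule) with Rabs. rewrite Rabs_mult.
    rewrite <- (Rmult_1_l ((/ 2) ^ _)).
    apply Rmult_le_compat; try apply Rabs_pos; [apply IH; lia|].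
    rewrite Rabs_pos_eq.
    + replace (n + 2 - i)%nat with (S (S n - i)) by lia. apply inv_fact_le.
    + apply Rlt_le, Rinv_0_lt_compat, INR_fact_lt_0.
Qed.

Definition expm1_coef (n : nat) : R := if (n =? 0)%nat then 0 else / INR (fact n).

Lemma is_pseries_expm1 (x : R) : is_pseries expm1_coef x (exp x - 1).
Proof.
  apply is_pseries_R, (is_series_decr_1 (V := R_NormedModule)).
  apply (is_series_incr_1 (fun n => / INR (fact n) * x ^ n)).
  assert (H := proj1 (is_pseries_R _ _ _) (is_exp_Reals x)).
  replace (plus _ _) with (exp x); [exact H|].
  unfold plus, opp, expm1_coef; simpl. field.
Qed.

Lemma CV_radius_all (a : nat -> R) :
  (forall x, ex_pseries a x) -> CV_radius a = p_infty.
Proof.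
  intros H. destruct (CV_radius a) as [r| |] eqn:E; [|reflexivity|].
  - exfalso. apply (CV_disk_outside a (Rabs r + 1)).
    + rewrite E. simpl. rewrite Rabs_pos_eq; generalize (Rle_abs r) (Rabs_pos r); lra.
    + apply ex_series_lim_0, ex_pseries_R, H.
  - generalize (CV_radius_ge_0 a). now rewrite E.
Qed.

Lemma CV_radius_expm1 : CV_radius expm1_coef = p_infty.
Proof.
  apply CV_radius_all. intros x. eexists. apply is_pseries_expm1.
Qed.

Lemma CV_radius_bernoulli_egf : Rbar_le 1 (CV_radius bernoulli_egf).
Proof.
  apply CV_radius_ge with 1. intros n. rewrite pow1, Rmult_1_r. apply bernoulli_egf_bound.
Qed.

Lemma PS_mult_bernoulli_egf (n : nat) :
  PS_mult bernoulli_egf expm1_coef n = if (n =? 1)%nat then 1 else 0.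
Proof.
  unfold PS_mult. rewrite <- sum_n_Reals.
  destruct n as [|[|n]].
  - rewrite sum_O. unfold expm1_coef; simpl. ring.
  - rewrite sum_Sn, sum_O. unfold expm1_coef, bernoulli_egf, plus; simpl.
    rewrite bernoulli_0. field.
  - rewrite !sum_Sn.
    rewrite (sum_n_ext_loc _ (fun i => bernoulli_egf i * / INR (fact (n + 2 - i)))).
    2: { intros i Hi. unfold expm1_coef.
         replace (S (S n) - i)%nat with (S (S n - i)) by lia.
         replace (n + 2 - i)%nat with (S (S n - i)) by lia. reflexivity. }
    replace (S (S n) - S n)%nat with 1%nat by lia.
    replace (S (S n) - S (S n))%nat with 0%nat by lia.
    rewrite bernoulli_egf_S. unfold expm1_coef; simpl. field_R.
Qed.

(** The recursion of the Bernoulli numbers says that the product of the two series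
    has the coefficients of [x]. *)
Lemma PSeries_bernoulli_egf (x : R) :
  Rabs x < 1 -> PSeries bernoulli_egf x * (exp x - 1) = x.
Proof.
  intros Hx.
  assert (H1 : Rbar_lt (Rabs x) (CV_radius bernoulli_egf)).
  { eapply Rbar_lt_le_trans; [|apply CV_radius_bernoulli_egf]. exact Hx. }
  assert (H2 : Rbar_lt (Rabs x) (CV_radius expm1_coef)) by now rewrite CV_radius_expm1.
  rewrite <- (is_pseries_unique _ _ _ (is_pseries_expm1 x)), <- PSeries_mult by assumption.
  apply is_pseries_unique, is_pseries_R.
  apply is_series_ext with (fun n => if (n =? 1)%nat then x else 0).
  { intros n. rewrite PS_mult_bernoulli_egf.
    destruct (Nat.eqb_spec n 1) as [->|]; simpl; ring. }
  apply is_series_single.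
Qed.

(** With [b(x) = x / (exp x - 1)] one has [x tanh x = x + b(4 x) - b(2 x)]; the term
    [x] only serves to cancel the contribution of [B_1], which explains the
    exceptional value at [0]. *)
Definition tanh_coef (n : nat) : R :=
  if (n =? 0)%nat then 0 else (4 ^ S n - 2 ^ S n) * bernoulli_egf (S n).

Lemma is_series_tanh_coef_aux (x : R) :
  Rabs x < 1 / 4 ->
  is_series (fun n => x * (tanh_coef n * x ^ n))
    (x + (PSeries bernoulli_egf (4 * x) - PSeries bernoulli_egf (2 * x))).
Proof.
  intros Hx.
  assert (Hb : forall c, 0 <= c <= 4 ->
     is_series (fun n => bernoulli_egf n * (c * x) ^ n) (PSeries bernoulli_egf (c * x))).
  { intros c Hc. apply is_pseries_R, PSeries_correct, CV_radius_inside.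
    eapply Rbar_lt_le_trans; [|apply CV_radius_bernoulli_egf].
    simpl. rewrite Rabs_mult, (Rabs_pos_eq c) by lra. generalize (Rabs_pos x). nra. }
  assert (H := is_series_minus (V := R_NormedModule) _ _ _ _
                 (Hb 4 ltac:(lra)) (Hb 2 ltac:(lra))).
  assert (H' : is_series (fun n => (4 ^ S n - 2 ^ S n) * bernoulli_egf (S n) * x ^ S n)
     (PSeries bernoulli_egf (4 * x) - PSeries bernoulli_egf (2 * x))).
  { eapply is_series_ext;
      [|apply (is_series_incr_1 (V := R_NormedModule)
          (fun n => plus (bernoulli_egf n * (4 * x) ^ n) (opp (bernoulli_egf n * (2 * x) ^ n))))].
    - intros n. cbv beta. rewrite !Rpow_mult_distr. unfold plus, opp; simpl. ring.
    - replace (plus _ _) with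
        (plus (PSeries bernoulli_egf (4 * x)) (opp (PSeries bernoulli_egf (2 * x)))).
      + exact H.
      + unfold plus, opp; simpl. ring. }
  assert (Hx1 := is_series_single 0 x).
  eapply is_series_ext; [|apply (is_series_plus (V := R_NormedModule) _ _ _ _ Hx1 H')].
  intros n. unfold plus, tanh_coef; simpl. destruct n as [|n]; simpl.
  - unfold bernoulli_egf. rewrite bernoulli_1. simpl. field.
  - ring.
Qed.

Lemma tanh_exp (x : R) : tanh x = (exp (2 * x) - 1) / (exp (2 * x) + 1).
Proof.
  unfold tanh, sinh, cosh. rewrite exp_Ropp.
  replace (2 * x) with (x + x) by ring. rewrite exp_plus.
  assert (H := exp_pos x). field. split; nra.
Qed.

Lemma PSeries_tanh_coef_near_0 (x : R) :
  Rabs x < 1 / 4 -> PSeries tanh_coef x = tanh x.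
Proof.
  intros Hx. destruct (Req_dec x 0) as [->|Hx0].
  - rewrite PSeries_0. unfold tanh. rewrite sinh_0. unfold tanh_coef; simpl. lra.
  - assert (Hb : forall c, 0 <= c <= 4 ->
      PSeries bernoulli_egf (c * x) * (exp (c * x) - 1) = c * x).
    { intros c Hc. apply PSeries_bernoulli_egf. rewrite Rabs_mult, (Rabs_pos_eq c) by lra.
      generalize (Rabs_pos x). nra. }
    assert (H2 := Hb 2 ltac:(lra)). assert (H4 := Hb 4 ltac:(lra)).
    assert (HE : exp (2 * x) <> 1).
    { intros E. rewrite <- exp_0 in E. apply exp_inv in E. lra. }
    replace (exp (4 * x)) with (exp (2 * x) * exp (2 * x)) in H4
      by (rewrite <- exp_plus; f_equal; ring).
    assert (HP := exp_pos (2 * x)). rewrite tanh_exp.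
    revert H2 H4 HE HP. generalize (exp (2 * x)). intros E H2 H4 HE HP.
    assert (HL := is_series_tanh_coef_aux x Hx).
    apply (is_series_scal_l (V := R_NormedModule) (/ x)) in HL.
    apply is_pseries_unique, is_pseries_R.
    replace ((E - 1) / (E + 1)) with
      (/ x * (x + (PSeries bernoulli_egf (4 * x) - PSeries bernoulli_egf (2 * x)))).
    + eapply is_series_ext; [|exact HL]. intros n.
      transitivity (/ x * (x * (tanh_coef n * x ^ n))); [reflexivity|].
      rewrite <- Rmult_assoc, Rinv_l, Rmult_1_l by assumption. reflexivity.
    + replace (PSeries bernoulli_egf (2 * x)) with (2 * x / (E - 1)).
      2: { apply Rmult_eq_reg_r with (E - 1); [rewrite H2; field|]; lra. }
      replace (PSeries bernoulli_egf (4 * x)) with (4 * x / (E * E - 1)).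
      2: { apply Rmult_eq_reg_r with (E * E - 1); [rewrite H4; field|]; nra. }
      field. repeat split; nra.
Qed.

Lemma CV_radius_tanh_coef_pos : Rbar_lt 0 (CV_radius tanh_coef).
Proof.
  apply Rbar_lt_le_trans with (1 / 4); [simpl; lra|].
  apply CV_radius_ge with 4. intros n. unfold tanh_coef.
  destruct (Nat.eqb_spec n 0); [rewrite Rmult_0_l, Rabs_R0; lra|].
  rewrite !Rabs_mult, <- RPow_abs, (Rabs_pos_eq (1 / 4)) by lra.
  assert (H := bernoulli_egf_bound (S n)). assert (H0 := Rabs_pos (bernoulli_egf (S n))).
  assert (H1 : 0 < 2 ^ S n) by (apply pow_lt; lra).
  assert (H2 : 2 ^ S n <= 4 ^ S n) by (apply pow_incr; lra).
  assert (H3 : 4 ^ S n * (1 / 4) ^ n = 4).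
  { cbn [pow]. rewrite Rmult_assoc, <- Rpow_mult_distr. replace (4 * (1 / 4)) with 1 by field.
    rewrite pow1. ring. }
  assert (H4 : 0 < (1 / 4) ^ n) by (apply pow_lt; lra).
  rewrite Rabs_pos_eq by lra.
  apply Rle_trans with (4 ^ S n * (1 / 4) ^ n); [|lra].
  apply Rmult_le_compat_r; [lra|]. nra.
Qed.

Lemma locally_0_abs_lt (r : R) (P : R -> Prop) :
  0 < r -> (forall x, Rabs x < r -> P x) -> locally 0 P.
Proof.
  intros Hr H. exists (mkposreal r Hr). intros y Hy. apply H.
  unfold ball in Hy; simpl in Hy. unfold AbsRing_ball, abs, minus, plus, opp in Hy.
  simpl in Hy. replace y with (y + - 0) by ring. exact Hy.
Qed.

Lemma CV_radius_mult_pos (a b : nat -> R) :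
  Rbar_lt 0 (CV_radius a) -> Rbar_lt 0 (CV_radius b) -> Rbar_lt 0 (CV_radius (PS_mult a b)).
Proof.
  intros Ha Hb.
  assert (E : exists r, 0 < r /\ Rbar_lt r (CV_radius a) /\ Rbar_lt r (CV_radius b)).
  { destruct (CV_radius a) as [ra| |], (CV_radius b) as [rb| |]; simpl in *; try easy.
    - exists (Rmin ra rb / 2). assert (0 < Rmin ra rb) by now apply Rmin_glb_lt.
      generalize (Rmin_l ra rb) (Rmin_r ra rb). repeat split; lra.
    - exists (ra / 2). repeat split; lra.
    - exists (rb / 2). repeat split; lra.
    - exists 1. repeat split; lra. }
  destruct E as [r [Hr [Hra Hrb]]].
  rewrite <- (Rabs_pos_eq r) in Hra, Hrb by lra.
  assert (H := ex_pseries_mult a b r Hra Hrb).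
  apply Rbar_lt_le_trans with r; [exact Hr|].
  apply Rbar_not_lt_le. intros Hlt.
  apply ex_pseries_R, ex_series_lim_0 in H.
  apply (CV_disk_outside (PS_mult a b) r); [|exact H].
  now rewrite Rabs_pos_eq by lra.
Qed.

Definition one_coef (n : nat) : R := if (n =? 0)%nat then 1 else 0.

Lemma is_pseries_one (x : R) : is_pseries one_coef x 1.
Proof.
  apply is_pseries_R. eapply is_series_ext; [|apply (is_series_single 0)].
  intros n. unfold one_coef. destruct (Nat.eqb_spec n 0) as [->|]; simpl; ring.
Qed.

Lemma CV_radius_one : CV_radius one_coef = p_infty.
Proof.
  apply CV_radius_all. intros x. eexists. apply is_pseries_one.
Qed.

(** The differential equation [tanh' = 1 - tanh ^ 2], read on coefficients. *)
Lemma tanh_coef_rec (n : nat) :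
  INR (S n) * tanh_coef (S n) =
  (if (n =? 0)%nat then 1 else 0) - sum_f_R0 (fun i => tanh_coef i * tanh_coef (n - i)) n.
Proof.
  assert (HC := CV_radius_tanh_coef_pos).
  change (PS_derive tanh_coef n =
    one_coef n - PS_mult tanh_coef tanh_coef n).
  rewrite <- (Rplus_minus_r (PS_derive tanh_coef n) (PS_mult tanh_coef tanh_coef n)).
  f_equal.
  change (PS_plus (PS_derive tanh_coef) (PS_mult tanh_coef tanh_coef) n = one_coef n).
  apply PSeries_ext_recip.
  - eapply Rbar_lt_le_trans; [|apply CV_radius_plus].
    apply Rbar_min_case; [now rewrite CV_radius_derive|now apply CV_radius_mult_pos].
  - now rewrite CV_radius_one.
  - assert (Hr : exists r, 0 < r <= 1 / 4 /\ Rbar_lt r (CV_radius tanh_coef)).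
    { destruct (CV_radius tanh_coef) as [r| |]; simpl in *; [|exists (1/4); split; auto; lra|easy].
      exists (Rmin (r / 2) (1 / 4)).
      generalize (Rmin_l (r / 2) (1 / 4)) (Rmin_r (r / 2) (1 / 4)).
      assert (0 < Rmin (r / 2) (1 / 4)) by (apply Rmin_glb_lt; lra). repeat split; lra. }
    destruct Hr as [r [Hr HrC]].
    apply locally_0_abs_lt with r; [lra|]. intros x Hx.
    assert (HxC : Rbar_lt (Rabs x) (CV_radius tanh_coef)).
    { eapply Rbar_lt_trans; [|exact HrC]. exact Hx. }
    rewrite (is_pseries_unique _ _ _ (is_pseries_one x)).
    rewrite PSeries_plus by (apply ex_pseries_derive || apply ex_pseries_mult; assumption).
    rewrite PSeries_mult by assumption.
    rewrite <- Derive_PSeries by assumption.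
    rewrite PSeries_tanh_coef_near_0 by lra.
    rewrite (Derive_ext_loc _ tanh).
    + rewrite (is_derive_unique tanh x (1 - tanh x * tanh x)); [ring|].
      assert (Hc : cosh x <> 0) by (unfold cosh; generalize (exp_pos x) (exp_pos (- x)); lra).
      unfold tanh, sinh, cosh in *. auto_derive; [lra|].
      field. lra.
    + assert (Hp : 0 < r - Rabs x) by lra.
      exists (mkposreal _ Hp). intros y Hy.
      apply PSeries_tanh_coef_near_0.
      unfold ball in Hy; simpl in Hy. unfold AbsRing_ball, abs, minus, plus, opp in Hy.
      simpl in Hy. assert (H := Rabs_triang (y + - x) x).
      rewrite Rplus_assoc, Rplus_opp_l, Rplus_0_r in H. lra.
Qed.

Lemma sum_conv_le_sqr (a : nat -> R) (N : nat) :
  (forall n, 0 <= a n) ->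
  sum_n (fun n => sum_f_R0 (fun i => a i * a (n - i)%nat) n) N <= (sum_n a N) ^ 2.
Proof.
  intros Ha. rewrite !sum_n_Reals. destruct N as [|N]; [simpl; lra|].
  rewrite <- Rsqr_pow2. unfold Rsqr. rewrite cauchy_finite by lia.
  rewrite <- (Rplus_0_r (sum_f_R0 _ (S N))) at 1.
  apply Rplus_le_compat_l, cond_pos_sum. intros n. apply cond_pos_sum. intros k.
  apply Rmult_le_pos; apply Ha.
Qed.

(** Truncating a product of series with nonnegative coefficients makes it smaller, so
    the hypothesis gives [P' <= 1 + P ^ 2] for the partial sum [P]. Then [atan P] has
    slope at most [1], and [atan (P r) <= r]. *)
Lemma partial_sum_le_tan (t : nat -> R) (N : nat) (r : R) :
  (forall n, 0 <= t n) -> t O = 0 ->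
  (forall n, INR (S n) * t (S n) <=
     (if (n =? 0)%nat then 1 else 0) + sum_f_R0 (fun i => t i * t (n - i)%nat) n) ->
  0 <= r < PI / 2 -> sum_n (fun n => t n * r ^ n) N <= tan r.
Proof.
  intros Ht Ht0 Hrec Hr.
  set (P := fun y => sum_n (fun n => t n * y ^ n) N).
  set (P' := fun y => sum_n (fun n => t n * (INR n * y ^ pred n)) N).
  assert (HP : forall y, is_derive P y (P' y)).
  { intros y. apply (is_derive_sum_n (fun n z => t n * z ^ n)).
    intros k _. auto_derive; [trivial|]. ring. }
  assert (HP' : forall y, 0 <= y -> P' y <= 1 + P y ^ 2).
  { intros y Hy. unfold P', P.
    assert (Hpow : forall n, 0 <= t n * y ^ n)
      by (intros; apply Rmult_le_pos; [apply Ht|now apply pow_le]).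
    destruct N as [|N].
    - rewrite !sum_O. rewrite Ht0. simpl. lra.
    - rewrite sum_n_shift. change (@plus R_AbelianMonoid) with Rplus.
      simpl INR at 1. rewrite Rmult_0_l, Rmult_0_r, Rplus_0_l.
      apply Rle_trans with
        (sum_n (fun n => (if (n =? 0)%nat then 1 else 0) +
           sum_f_R0 (fun i => (t i * y ^ i) * (t (n - i)%nat * y ^ (n - i))) n) N).
      + apply sum_n_le. intros n _. cbn [pred].
        replace (sum_f_R0 (fun i => (t i * y ^ i) * (t (n - i)%nat * y ^ (n - i))) n)
          with (y ^ n * sum_f_R0 (fun i => t i * t (n - i)%nat) n).
        2: { rewrite scal_sum. apply sum_eq. intros i Hi.
             assert (Ey : y ^ n = y ^ i * y ^ (n - i)) by (rewrite <- pow_add; f_equal; lia).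
             rewrite Ey. ring. }
        replace (if (n =? 0)%nat then 1 else 0)
          with (y ^ n * (if (n =? 0)%nat then 1 else 0))
          by (destruct (Nat.eqb_spec n 0) as [->|]; simpl; ring).
        rewrite <- Rmult_plus_distr_l.
        replace (t (S n) * (INR (S n) * y ^ n)) with (y ^ n * (INR (S n) * t (S n))) by ring.
        apply Rmult_le_compat_l; [now apply pow_le|apply Hrec].
      + rewrite (sum_n_plus (G := R_AbelianMonoid)
           (fun n => if (n =? 0)%nat then 1 else 0)).
        change (@plus R_AbelianMonoid) with Rplus. apply Rplus_le_compat.
        * apply Rle_trans with 1; [|lra].
          apply (sum_n_le_is_series _ 1 N); [|apply (is_series_single 0)].
          intros n. destruct (n =? 0)%nat; lra.
        * eapply Rle_trans; [apply (sum_conv_le_sqr (fun n => t n * y ^ n)); auto|].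
          rewrite sum_Sn. change (@plus R_AbelianMonoid) with Rplus.
          apply pow_incr. specialize (Hpow (S N)).
          split; [|lra]. apply sum_n_ge_0. intros n _.
          apply Rmult_le_pos; [apply Ht|now apply pow_le]. }
  destruct (MVT_gen (fun y => y - atan (P y)) 0 r
              (fun y => 1 - P' y * / (1 + (P y)²))) as [c [Hc E]].
  { intros y _. apply (is_derive_minus (V := R_NormedModule) (fun y => y)).
    - apply (is_derive_id (K := R_AbsRing)).
    - apply (is_derive_comp atan P); [apply is_derive_atan|apply HP]. }
  { intros y _. apply derivable_continuous_pt.
    exists (1 - P' y * / (1 + (P y)²)). apply is_derive_Reals.
    apply (is_derive_minus (V := R_NormedModule) (fun y => y)).
    - apply (is_derive_id (K := R_AbsRing)).
    - apply (is_derive_comp atan P); [apply is_derive_atan|apply HP]. }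
  rewrite Rmin_left in Hc by lra.
  assert (H0 : P 0 = 0).
  { unfold P. rewrite (sum_n_ext _ (fun _ => 0)).
    - rewrite sum_n_const. ring_R.
    - intros [|n]; [rewrite Ht0; ring_R|simpl; ring_R]. }
  rewrite H0, atan_0 in E.
  assert (Hs : P' c * / (1 + (P c)²) <= 1).
  { assert (H := Rle_0_sqr (P c)). apply (Rle_div_l (P' c)); [lra|].
    specialize (HP' c ltac:(lra)). unfold Rsqr in *. simpl in HP'. lra. }
  assert (Hle : atan (P r) <= r) by nra.
  change (P r <= tan r).
  rewrite <- (tan_atan (P r)). destruct Hle as [Hlt|Heq].
  - apply Rlt_le, tan_increasing; [apply atan_bound|assumption|lra].
  - rewrite Heq. apply Rle_refl.
Qed.

(** The absolute values of the coefficients satisfy the hypothesis of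
    [partial_sum_le_tan], so their partial sums are bounded at every [q < PI / 2]. *)
Lemma CV_radius_tanh_coef (r : R) : r < PI / 2 -> Rbar_lt r (CV_radius tanh_coef).
Proof.
  intros Hr. set (q := (Rmax r 0 + PI / 2) / 2).
  assert (Hq : 0 <= q < PI / 2 /\ r < q).
  { unfold q. assert (H := PI_RGT_0). assert (Rmax r 0 < PI / 2) by (apply Rmax_lub_lt; lra).
    generalize (Rmax_l r 0) (Rmax_r r 0). lra. }
  apply Rbar_lt_le_trans with q; [simpl; lra|].
  apply CV_radius_ge with (tan q). intros n.
  rewrite Rabs_mult, (Rabs_pos_eq (q ^ n)) by (apply pow_le; lra).
  assert (Hpos : forall k, 0 <= Rabs (tanh_coef k) * q ^ k)
    by (intros; apply Rmult_le_pos; [apply Rabs_pos|apply pow_le; lra]).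
  apply Rle_trans with (sum_n (fun n => Rabs (tanh_coef n) * q ^ n) n).
  - destruct n as [|n]; [rewrite sum_O; apply Rle_refl|].
    rewrite sum_Sn. change (@plus R_AbelianMonoid) with Rplus.
    assert (0 <= sum_n (fun n => Rabs (tanh_coef n) * q ^ n) n) by (apply sum_n_ge_0; auto).
    lra.
  - apply partial_sum_le_tan; try tauto.
    + intros; apply Rabs_pos.
    + apply Rabs_R0.
    + intros k. rewrite <- (Rabs_pos_eq (INR (S k))) by apply pos_INR.
      rewrite <- Rabs_mult, tanh_coef_rec. unfold Rminus.
      eapply Rle_trans; [apply Rabs_triang|]. apply Rplus_le_compat.
      * destruct (k =? 0)%nat; rewrite Rabs_pos_eq; lra.
      * rewrite Rabs_Ropp. eapply Rle_trans; [apply Rsum_abs|].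
        apply sum_Rle. intros i _. rewrite Rabs_mult. lra.
Qed.

(** The identity [tanh x * (exp (2 x) + 1) = exp (2 x) - 1] between power series
    passes from a neighbourhood of [0] to the whole disc through the coefficients. *)
Lemma PSeries_tanh_coef (x : R) :
  Rabs x < PI / 2 -> PSeries tanh_coef x = tanh x.
Proof.
  intros Hx.
  set (e := fun n => / INR (fact n) * 2 ^ n).
  assert (He : forall y, is_pseries e y (exp (2 * y))).
  { intros y. apply is_pseries_R.
    eapply is_series_ext; [|exact (proj1 (is_pseries_R _ _ _) (is_exp_Reals (2 * y)))].
    intros n. unfold e. rewrite Rpow_mult_distr. ring_R. }
  set (p := PS_plus e one_coef). set (m := PS_minus e one_coef).
  assert (Hp : forall y, is_pseries p y (exp (2 * y) + 1))
    by (intros y; apply (is_pseries_plus (V := R_NormedModule)); [apply He|apply is_pseries_one]).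
  assert (Hm : forall y, is_pseries m y (exp (2 * y) - 1))
    by (intros y; apply (is_pseries_minus (V := R_NormedModule)); [apply He|apply is_pseries_one]).
  assert (Cp : CV_radius p = p_infty)
    by (apply CV_radius_all; intros y; eexists; apply Hp).
  assert (Cm : CV_radius m = p_infty)
    by (apply CV_radius_all; intros y; eexists; apply Hm).
  assert (Hq := PI2_1).
  assert (HT : forall y, Rabs y < PI / 2 -> Rbar_lt (Rabs y) (CV_radius tanh_coef))
    by (intros; now apply CV_radius_tanh_coef).
  assert (Hmul : forall y, Rabs y < PI / 2 ->
    PSeries (PS_mult tanh_coef p) y = PSeries tanh_coef y * (exp (2 * y) + 1)).
  { intros y Hy. rewrite PSeries_mult; [|now apply HT|now rewrite Cp].
    now rewrite (is_pseries_unique _ _ _ (Hp y)). }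
  assert (E : forall n, PS_mult tanh_coef p n = m n).
  { intros n. apply PSeries_ext_recip.
    - apply CV_radius_mult_pos; [apply CV_radius_tanh_coef_pos|now rewrite Cp].
    - now rewrite Cm.
    - apply locally_0_abs_lt with (1 / 4); [lra|]. intros y Hy.
      rewrite Hmul by lra. rewrite (is_pseries_unique _ _ _ (Hm y)).
      rewrite PSeries_tanh_coef_near_0, tanh_exp by assumption.
      assert (H := exp_pos (2 * y)). field. lra. }
  assert (H := Hmul x Hx). rewrite (PSeries_ext _ m) in H by exact E.
  rewrite (is_pseries_unique _ _ _ (Hm x)) in H. rewrite tanh_exp, H.
  assert (H' := exp_pos (2 * x)). field. lra.
Qed.

(** In the quadratic recursion for an even index, each product has a factor of
    smaller even index. *)
Lemma tanh_coef_even (n : nat) : tanh_coef (2 * n) = 0.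
Proof.
  induction n as [n IH] using lt_wf_ind. destruct n as [|n]; [reflexivity|].
  apply Rmult_eq_reg_l with (INR (S (2 * n + 1))); [|apply not_0_INR; lia].
  replace (2 * S n)%nat with (S (2 * n + 1)) by lia.
  rewrite tanh_coef_rec, (sum_eq _ (fun _ => 0)).
  - destruct (Nat.eqb_spec (2 * n + 1) 0); [lia|].
    rewrite sum_cte. ring.
  - intros i Hi. destruct (Nat.Even_or_Odd i) as [[k ->]|[k ->]].
    + rewrite IH by lia. ring.
    + replace (2 * n + 1 - (2 * k + 1))%nat with (2 * (n - k))%nat by lia.
      rewrite (IH (n - k)%nat) by lia. ring.
Qed.

Lemma is_series_tanh (x : R) :
  Rabs x < PI / 2 ->
  is_series (fun m => tanh_coef (2 * m + 1) * x ^ (2 * m + 1)) (tanh x) /\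
  ex_series (fun m => Rabs (tanh_coef (2 * m + 1) * x ^ (2 * m + 1))).
Proof.
  intros Hx.
  assert (HC : Rbar_lt (Rabs x) (CV_radius tanh_coef)) by now apply CV_radius_tanh_coef.
  split.
  - apply (is_series_odd (fun n => tanh_coef n * x ^ n)).
    + intros n. rewrite tanh_coef_even. ring.
    + apply is_pseries_R. rewrite <- PSeries_tanh_coef by assumption.
      now apply PSeries_correct, CV_radius_inside.
  - destruct (CV_disk_inside _ _ HC) as [l Hl]. exists l.
    apply (is_series_odd (fun n => Rabs (tanh_coef n * x ^ n))); [|exact Hl].
    intros n. rewrite tanh_coef_even, Rmult_0_l. apply Rabs_R0.
Qed.

(** * The expansion of the deformation factor *)

Lemma pow_div (x y : R) (n : nat) : (x / y) ^ n = x ^ n / y ^ n.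
Proof.
  unfold Rdiv. now rewrite Rpow_mult_distr, pow_inv.
Qed.

(** In the binomial expansion the terms with an odd power of [x] cancel. *)
Lemma odd_power_diff (x h : R) (m : nat) :
  / 2 * ((x + h) ^ (2 * m + 1) - (x - h) ^ (2 * m + 1)) =
  sum_n (fun n => Binomial.C (2 * m + 1) (2 * n) * x ^ (2 * n) * h ^ (2 * m + 1 - 2 * n)) m.
Proof.
  unfold Rminus at 2. rewrite !binomial, <- !sum_n_Reals, !sum_n_pairs.
  set (u := fun n => Binomial.C (2 * m + 1) (2 * n) * x ^ (2 * n) * h ^ (2 * m + 1 - 2 * n)).
  set (v := fun n => Binomial.C (2 * m + 1) (2 * n + 1) * x ^ (2 * n + 1) *
                       h ^ (2 * m + 1 - (2 * n + 1))).
  assert (E1 : sum_n (fun n => u n + v n) m = sum_n u m + sum_n v m)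
    by apply (sum_n_plus (G := R_AbelianMonoid)).
  assert (E2 : sum_n (fun n =>
      Binomial.C (2 * m + 1) (2 * n) * x ^ (2 * n) * (- h) ^ (2 * m + 1 - 2 * n) +
      Binomial.C (2 * m + 1) (2 * n + 1) * x ^ (2 * n + 1) *
        (- h) ^ (2 * m + 1 - (2 * n + 1))) m = sum_n v m - sum_n u m).
  { transitivity (sum_n (fun n => plus (v n) (scal (-1) (u n))) m).
    - apply sum_n_ext_loc. intros n Hn.
      change (plus (v n) (scal (-1) (u n))) with (v n + -1 * u n). unfold u, v.
      replace (2 * m + 1 - 2 * n)%nat with (S (2 * (m - n))) by lia.
      replace (2 * m + 1 - (2 * n + 1))%nat with (2 * (m - n))%nat by lia.
      replace (- h) with (-1 * h) by ring. rewrite !Rpow_mult_distr.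
      cbn [pow]. rewrite pow_1_even. ring_R.
    - rewrite sum_n_plus, (sum_n_scal_l (V := R_NormedModule)).
      change (sum_n v m + -1 * sum_n u m = sum_n v m - sum_n u m). ring. }
  cbv beta. fold u v.
  change (/ 2 * (sum_n (fun n => u n + v n) m - sum_n (fun n =>
      Binomial.C (2 * m + 1) (2 * n) * x ^ (2 * n) * (- h) ^ (2 * m + 1 - 2 * n) +
      Binomial.C (2 * m + 1) (2 * n + 1) * x ^ (2 * n + 1) *
        (- h) ^ (2 * m + 1 - (2 * n + 1))) m) = sum_n u m).
  rewrite E1, E2. field.
Qed.

Lemma a_term_eq (kappa : R) (n m : nat) :
  kappa <> 0 -> (n <= m)%nat ->
  a_term kappa n (m + 1) =
  tanh_coef (2 * m + 1) / kappa ^ (2 * m + 1) *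
    (Binomial.C (2 * m + 1) (2 * n) * (1 / 2) ^ (2 * m + 1 - 2 * n)).
Proof.
  intros Hk Hn. unfold a_term, tanh_coef, bernoulli_egf, Binomial.C.
  destruct (Nat.eqb_spec (2 * m + 1) 0); [lia|].
  replace (S (2 * m + 1)) with (2 * (m + 1))%nat by lia.
  replace (2 * (m + 1) - 2 * n - 1)%nat with (2 * m + 1 - 2 * n)%nat by lia.
  replace (2 * (m + 1) - 1)%nat with (2 * m + 1)%nat by lia.
  replace (fact (2 * (m + 1))) with (2 * (m + 1) * fact (2 * m + 1))%nat.
  2: { replace (2 * (m + 1))%nat with (S (2 * m + 1)) by lia. reflexivity. }
  rewrite !mult_INR.
  replace (4 ^ (2 * (m + 1))) with (2 ^ (2 * (m + 1)) * 2 ^ (2 * (m + 1)))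
    by (rewrite <- Rpow_mult_distr; f_equal; ring).
  replace (2 ^ (2 * n)) with (2 ^ (2 * (m + 1)) * (1 / 2) ^ (2 * m + 1 - 2 * n) / 2).
  2: { replace (2 * (m + 1))%nat with (2 * n + (2 * m + 1 - 2 * n) + 1)%nat by lia.
       rewrite !pow_add. set (d := (2 * m + 1 - 2 * n)%nat).
       assert (E : 2 ^ d * (1 / 2) ^ d = 1).
       { rewrite <- Rpow_mult_distr. replace (2 * (1 / 2)) with 1 by field. apply pow1. }
       transitivity (2 ^ (2 * n) * (2 ^ d * (1 / 2) ^ d)); [field|rewrite E; ring]. }
  assert (Hm : INR (m + 1) <> 0) by (apply not_0_INR; lia).
  assert (Hkn : kappa ^ (2 * m + 1) <> 0) by now apply pow_nonzero.
  simpl (INR 2).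
  generalize (2 ^ (2 * (m + 1))) ((1 / 2) ^ (2 * m + 1 - 2 * n)) (bernoulli (2 * (m + 1))).
  intros A D B. field. repeat split; try assumption; apply INR_fact_neq_0.
Qed.

Definition calB_coef (kappa : R) (n : nat) : R :=
  Series (fun i => a_term kappa n (n + 1 + i)).

(** The binomial expansion of the [m]-th odd power only has terms with [n <= m]; the
    index [j] of [a_term] is [m + 1]. *)
Definition calB_double (kappa x : R) (n m : nat) : R :=
  if (n <=? m)%nat then a_term kappa n (m + 1) * x ^ (2 * n) else 0.

Lemma is_series_calB_double_n (kappa x : R) (m : nat) :
  kappa <> 0 ->
  is_series (fun n => calB_double kappa x n m)
    (tanh_coef (2 * m + 1) / kappa ^ (2 * m + 1) *
       (/ 2 * ((x + 1 / 2) ^ (2 * m + 1) - (x - 1 / 2) ^ (2 * m + 1)))).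
Proof.
  intros Hk. rewrite odd_power_diff.
  rewrite <- (sum_n_mult_l (K := R_Ring)).
  match goal with |- is_series _ ?s =>
    replace s with (sum_n (fun n => calB_double kappa x n m) m) end.
  - apply (is_series_finite (V := R_NormedModule)). intros n Hn.
    unfold calB_double. destruct (Nat.leb_spec n m); [lia|reflexivity].
  - apply sum_n_ext_loc. intros n Hn. unfold calB_double.
    destruct (Nat.leb_spec n m); [|lia].
    rewrite a_term_eq by assumption. ring_R.
Qed.

Lemma is_series_calB_double_abs (kappa x : R) (m : nat) :
  kappa <> 0 ->
  is_series (fun n => Rabs (calB_double kappa x n m))
    (Rabs (tanh_coef (2 * m + 1) / kappa ^ (2 * m + 1)) *
       (/ 2 * ((Rabs x + 1 / 2) ^ (2 * m + 1) - (Rabs x - 1 / 2) ^ (2 * m + 1)))).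
Proof.
  intros Hk. rewrite odd_power_diff.
  rewrite <- (sum_n_mult_l (K := R_Ring)).
  match goal with |- is_series _ ?s =>
    replace s with (sum_n (fun n => Rabs (calB_double kappa x n m)) m) end.
  - apply (is_series_finite (V := R_NormedModule)). intros n Hn.
    unfold calB_double. destruct (Nat.leb_spec n m); [lia|apply Rabs_R0].
  - apply sum_n_ext_loc. intros n Hn. unfold calB_double.
    destruct (Nat.leb_spec n m); [|lia].
    rewrite a_term_eq by assumption.
    rewrite !Rabs_mult, <- !RPow_abs, (Rabs_pos_eq (Binomial.C _ _)) by apply binom_nonneg.
    rewrite (Rabs_pos_eq (1 / 2)) by lra. ring_R.
Qed.

Lemma kappa_pos (kappa : R) : 3 / PI < kappa -> 0 < kappa.
Proof.
  intros Hk. apply Rlt_trans with (3 / PI); [|assumption].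
  apply Rdiv_lt_0_compat; [lra|apply PI_RGT_0].
Qed.

Lemma ex_series_calB_double_abs (kappa x : R) :
  3 / PI < kappa -> Rabs x <= 1 ->
  ex_series (fun m => Rabs (tanh_coef (2 * m + 1) / kappa ^ (2 * m + 1)) *
       (/ 2 * ((Rabs x + 1 / 2) ^ (2 * m + 1) - (Rabs x - 1 / 2) ^ (2 * m + 1)))).
Proof.
  intros Hk Hx. assert (HPI := PI_RGT_0). assert (Hk0 := kappa_pos kappa Hk).
  assert (Hr : Rabs (3 / 2 / kappa) < PI / 2).
  { rewrite Rabs_pos_eq by (apply Rdiv_le_0_compat; lra).
    apply Rlt_div_l; [assumption|]. apply Rlt_div_l in Hk; lra. }
  apply (ex_series_le (V := R_CompleteNormedModule) _
           (fun m => Rabs (tanh_coef (2 * m + 1) * (3 / 2 / kappa) ^ (2 * m + 1))));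
    [|apply is_series_tanh; assumption].
  intros m. change (@norm R_AbsRing R_CompleteNormedModule) with Rabs.
  rewrite pow_div. set (N := (2 * m + 1)%nat).
  unfold Rdiv at 1 4. rewrite !Rabs_mult, !Rabs_Rabsolu.
  replace (Rabs (tanh_coef N) * (Rabs ((3 / 2) ^ N) * Rabs (/ kappa ^ N)))
    with (Rabs (tanh_coef N) * Rabs (/ kappa ^ N) * Rabs ((3 / 2) ^ N)) by ring.
  apply Rmult_le_compat_l; [apply Rmult_le_pos; apply Rabs_pos|].
  assert (H1 : Rabs ((Rabs x + 1 / 2) ^ N) <= Rabs ((3 / 2) ^ N)).
  { rewrite <- !RPow_abs. apply pow_incr. split; [apply Rabs_pos|].
    generalize (Rabs_pos x). intros.
    rewrite (Rabs_pos_eq (Rabs x + 1 / 2)), (Rabs_pos_eq (3 / 2)); lra. }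
  assert (H2 : Rabs ((Rabs x - 1 / 2) ^ N) <= Rabs ((3 / 2) ^ N)).
  { rewrite <- !RPow_abs. apply pow_incr. split; [apply Rabs_pos|].
    generalize (Rabs_pos x). intros. rewrite (Rabs_pos_eq (3 / 2)) by lra.
    apply Rabs_le; lra. }
  rewrite (Rabs_pos_eq (/ 2)) by lra.
  assert (H3 := Rabs_triang ((Rabs x + 1 / 2) ^ N) (- (Rabs x - 1 / 2) ^ N)).
  rewrite Rabs_Ropp in H3. unfold Rminus in *. lra.
Qed.

Lemma ex_series_calB_double (kappa x : R) (n : nat) :
  3 / PI < kappa -> Rabs x <= 1 -> ex_series (calB_double kappa x n).
Proof.
  intros Hk Hx.
  assert (Hk0 := kappa_pos kappa Hk).
  eapply (ex_series_le (V := R_CompleteNormedModule));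
    [|apply (ex_series_calB_double_abs kappa x Hk Hx)].
  intros m. change (@norm R_AbsRing R_CompleteNormedModule) with Rabs.
  eapply Rle_trans; [|apply (sum_n_le_is_series _ _ n (fun _ => Rabs_pos _)
                               (is_series_calB_double_abs kappa x m ltac:(lra)))].
  cbv beta. destruct n as [|n]; [rewrite sum_O; apply Rle_refl|].
  rewrite sum_Sn. change (@plus R_AbelianMonoid) with Rplus.
  generalize (sum_n_ge_0 (fun n => Rabs (calB_double kappa x n m)) n (fun _ _ => Rabs_pos _)).
  lra.
Qed.

Lemma ex_series_a_term (kappa : R) (n : nat) :
  3 / PI < kappa -> ex_series (fun i => a_term kappa n (n + 1 + i)).
Proof.
  intros Hk.
  assert (H := ex_series_calB_double kappa 1 n Hk ltac:(rewrite Rabs_R1; lra)).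
  apply (ex_series_incr_n _ n) in H.
  eapply ex_series_ext; [|exact H]. intros i. unfold calB_double.
  destruct (Nat.leb_spec n (n + i)); [|lia].
  rewrite pow1, Rmult_1_r. f_equal. lia.
Qed.

Lemma is_series_calB_double_m (kappa x : R) (n : nat) :
  3 / PI < kappa -> is_series (calB_double kappa x n) (calB_coef kappa n * x ^ (2 * n)).
Proof.
  intros Hk.
  assert (H := Series_correct _ (ex_series_a_term kappa n Hk)).
  fold (calB_coef kappa n) in H.
  apply (is_series_scal_r (x ^ (2 * n))) in H.
  assert (Hd : forall i, calB_double kappa x n (n + i) =
                 a_term kappa n (n + 1 + i) * x ^ (2 * n)).
  { intros i. unfold calB_double. destruct (Nat.leb_spec n (n + i)); [|lia].
    do 2 f_equal. lia. }
  destruct n as [|n].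
  - eapply is_series_ext; [|exact H]. intros i. symmetry. exact (Hd i).
  - apply (is_series_decr_n (V := R_NormedModule) _ (S n)); [lia|].
    rewrite (sum_n_ext_loc _ (fun _ => 0)).
    2: { intros i Hi. unfold calB_double. destruct (Nat.leb_spec (S n) i); [|reflexivity].
         cbn [Init.Nat.pred] in Hi. lia. }
    rewrite sum_n_const, Rmult_0_r.
    replace (plus _ _) with (calB_coef kappa (S n) * x ^ (2 * S n)).
    + eapply is_series_ext; [|exact H]. intros i. symmetry. exact (Hd i).
    + unfold plus, opp; simpl. ring_R.
Qed.

Lemma is_series_calB (kappa x : R) :
  3 / PI < kappa -> Rabs x <= 1 ->
  is_series (fun n => calB_coef kappa n * x ^ (2 * n)) (calB kappa x) /\
  ex_series (fun n => Rabs (calB_coef kappa n * x ^ (2 * n))).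
Proof.
  intros Hk Hx.
  assert (Hk0 := kappa_pos kappa Hk).
  apply (is_series_swap (V := R_CompleteNormedModule) (calB_double kappa x) _ _ _ _
           (fun m => is_series_calB_double_abs kappa x m ltac:(lra))
           (ex_series_calB_double_abs kappa x Hk Hx)
           (fun m => is_series_calB_double_n kappa x m ltac:(lra))
           (fun n => is_series_calB_double_m kappa x n Hk)).
  assert (Hb : forall h, Rabs h = 1 / 2 -> Rabs ((x + h) / kappa) < PI / 2).
  { intros h Hh. unfold Rdiv at 1. rewrite Rabs_mult, Rabs_inv, (Rabs_pos_eq kappa) by lra.
    apply Rlt_div_l; [assumption|]. apply Rlt_div_l in Hk; [|apply PI_RGT_0].
    generalize (Rabs_triang x h). lra. }
  destruct (is_series_tanh _ (Hb (1 / 2) ltac:(rewrite Rabs_pos_eq; lra))) as [H1 _].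
  destruct (is_series_tanh _ (Hb (- (1 / 2)) ltac:(rewrite Rabs_left; lra))) as [H2 _].
  assert (H := is_series_scal_l (V := R_NormedModule) (1 / 2) _ _
                 (is_series_minus (V := R_NormedModule) _ _ _ _ H1 H2)).
  eapply is_series_ext; [|exact H].
  intros m.
  transitivity (1 / 2 * (tanh_coef (2 * m + 1) * ((x + 1 / 2) / kappa) ^ (2 * m + 1) +
    - (tanh_coef (2 * m + 1) * ((x + - (1 / 2)) / kappa) ^ (2 * m + 1)))); [reflexivity|].
  rewrite !pow_div. assert (Hkn : kappa ^ (2 * m + 1) <> 0) by (apply pow_nonzero; lra).
  unfold Rminus. field_R. exact Hkn.
Qed.

Lemma calB_0 (kappa : R) : kappa <> 0 -> calB kappa 0 = tanh (1 / (2 * kappa)).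
Proof.
  intros Hk. unfold calB.
  replace ((0 - 1 / 2) / kappa) with (- (1 / (2 * kappa))) by now field.
  replace ((0 + 1 / 2) / kappa) with (1 / (2 * kappa)) by now field.
  unfold tanh.
  replace (sinh (- (1 / (2 * kappa)))) with (- sinh (1 / (2 * kappa)))
    by (unfold sinh; rewrite Ropp_involutive; field).
  replace (cosh (- (1 / (2 * kappa)))) with (cosh (1 / (2 * kappa)))
    by (unfold cosh; rewrite Ropp_involutive; field).
  field. unfold cosh. generalize (exp_pos (1 / (2 * kappa))) (exp_pos (- (1 / (2 * kappa)))). lra.
Qed.

Lemma tanh_pos (x : R) : 0 < x -> 0 < tanh x.
Proof.
  intros Hx. rewrite tanh_exp. assert (H : exp 0 < exp (2 * x)) by (apply exp_increasing; lra).
  rewrite exp_0 in H. apply Rdiv_lt_0_compat; lra.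
Qed.

Lemma is_series_a_coef (kappa x : R) :
  3 / PI < kappa -> Rabs x <= 1 ->
  is_series (fun n => a_coef kappa n * x ^ (2 * n)) (calB kappa x / calB kappa 0) /\
  ex_series (fun n => Rabs (a_coef kappa n * x ^ (2 * n))).
Proof.
  intros Hk Hx.
  assert (Hk0 := kappa_pos kappa Hk).
  destruct (is_series_calB kappa x Hk Hx) as [H1 H2].
  assert (E : forall n, a_coef kappa n * x ^ (2 * n) =
     scal (/ calB kappa 0) (calB_coef kappa n * x ^ (2 * n))).
  { intros n. unfold a_coef, scal; simpl. unfold mult; simpl.
    rewrite calB_0 by lra. unfold Rdiv, calB_coef. ring_R. }
  split.
  - replace (calB kappa x / calB kappa 0) with (scal (/ calB kappa 0) (calB kappa x))
      by (unfold scal; simpl; unfold mult; simpl; unfold Rdiv; ring_R).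
    eapply is_series_ext; [|apply (is_series_scal_l (V := R_NormedModule)), H1].
    intros n. symmetry; apply E.
  - eapply ex_series_ext; [|apply (ex_series_scal_l (V := R_NormedModule)
        (Rabs (/ calB kappa 0))), H2].
    intros n. cbv beta. rewrite E. symmetry. apply Rabs_mult.
Qed.

(** Evaluate the expansion at [x = 0]. *)
Lemma a_coef_0 (kappa : R) : 3 / PI < kappa -> a_coef kappa 0 = 1.
Proof.
  intros Hk.
  assert (Hk0 := kappa_pos kappa Hk).
  destruct (is_series_a_coef kappa 0 Hk ltac:(rewrite Rabs_R0; lra)) as [H _].
  apply is_series_unique in H.
  assert (H0 : is_series (fun n => a_coef kappa n * 0 ^ (2 * n)) (a_coef kappa 0)).
  { eapply is_series_ext; [|apply (is_series_single 0 (a_coef kappa 0))].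
    intros n. cbv beta. destruct (Nat.eqb_spec n 0) as [->|Hn].
    - symmetry. apply Rmult_1_r.
    - rewrite pow_i by lia. symmetry. apply Rmult_0_r. }
  apply is_series_unique in H0. rewrite H0 in H. rewrite H.
  apply Rdiv_diag. rewrite calB_0 by lra.
  apply Rgt_not_eq, tanh_pos, Rdiv_lt_0_compat; lra.
Qed.

(** * Resummation of the deformed eta function *)

Definition eta_arg (nu : R) (s : C) (n : nat) : C := (s + 2 * nu * INR n)%C.

Lemma Re_eta_arg (nu : R) (s : C) (n : nat) :
  Re (eta_arg nu s n) = Re s + 2 * nu * INR n.
Proof.
  unfold eta_arg. destruct s. simpl. ring.
Qed.

Lemma Rpow_C_eta_arg (x nu : R) (s : C) (n : nat) :
  (/ Rpow_C x (eta_arg nu s n) = / Rpow_C x s * RtoC ((1 / Rpower x nu) ^ (2 * n)))%C.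
Proof.
  unfold Rpow_C, eta_arg. rewrite <- !Cexp_opp.
  replace ((1 / Rpower x nu) ^ (2 * n)) with (exp (- (2 * nu * INR n) * ln x)).
  - rewrite <- Cexp_RtoC, <- Cexp_plus. f_equal.
    rewrite RtoC_mult, RtoC_opp, !RtoC_mult. ring.
  - unfold Rpower. rewrite <- Rpower_pow.
    + unfold Rpower. f_equal.
      replace (1 / exp (nu * ln x)) with (exp (- (nu * ln x)))
        by (rewrite exp_Ropp; field; apply Rgt_not_eq, exp_pos).
      rewrite ln_exp, mult_INR. simpl. ring.
    + apply Rdiv_lt_0_compat; [lra|apply exp_pos].
Qed.

(** For fixed [k] the Euler transform is a finite sum over [m], in which the factor
    [B(x) / B(0)] with [x = (m + 1) ^ (- nu)] is expanded; [x ^ (2 n)] shifts the exponent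
    [s] by [2 nu n]. *)
Lemma eta_kn_term_series (kappa nu : R) (s : C) (k : nat) :
  3 / PI < kappa -> 0 < nu ->
  is_series (fun n => RtoC (a_coef kappa n) * eta_term (eta_arg nu s n) k)%C
    (eta_kn_term kappa nu s k).
Proof.
  intros Hk Hnu.
  set (x := fun m => 1 / Rpower (INR (m + 1)) nu).
  set (b := fun m => (RtoC (Binomial.C k m) * (RtoC ((-1) ^ m) / Rpow_C (INR (m + 1)) s))%C).
  assert (Hx : forall m, Rabs (x m) <= 1).
  { intros m. unfold x. assert (H1 : 1 <= INR (m + 1)).
    { change 1 with (INR 1). apply le_INR. lia. }
    assert (H2 : 1 <= Rpower (INR (m + 1)) nu).
    { rewrite <- (Rpower_O (INR (m + 1))) by lra. apply Rle_Rpower; lra. }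
    rewrite Rabs_pos_eq by (apply Rdiv_le_0_compat; lra).
    apply Rle_div_l; lra. }
  assert (H : is_series
    (fun n => sum_n (fun m => scal (b m) (RtoC (a_coef kappa n * x m ^ (2 * n)))) k)
    (sum_n (fun m => scal (b m) (RtoC (calB kappa (x m) / calB kappa 0))) k)).
  { apply (is_series_sum_n (V := C_NormedModule)
      (fun m n => scal (b m) (RtoC (a_coef kappa n * x m ^ (2 * n))))
      (fun m => scal (b m) (RtoC (calB kappa (x m) / calB kappa 0)))).
    intros m _. apply (is_series_scal (V := C_NormedModule)), is_series_RtoC,
      is_series_a_coef; [assumption|apply Hx]. }
  apply (is_series_scal (V := C_NormedModule) (RtoC (1 / 2 ^ (k + 1)))) in H.
  eapply is_series_ext; [|exact H].
  intros n. unfold eta_term.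
  change (@scal C_AbsRing C_NormedModule) with Cmult.
  rewrite Cmult_assoc, (Cmult_comm (RtoC (a_coef kappa n))), <- Cmult_assoc.
  change (RtoC (1 / 2 ^ (k + 1)) * sum_n (fun m => b m * RtoC (a_coef kappa n * x m ^ (2 * n))) k =
    RtoC (1 / 2 ^ (k + 1)) * (RtoC (a_coef kappa n) *
     sum_n (fun m => RtoC (Binomial.C k m) *
       (RtoC ((-1) ^ m) / Rpow_C (INR (m + 1)) (eta_arg nu s n))) k))%C.
  f_equal. rewrite <- (sum_n_mult_l (K := C_Ring)). apply sum_n_ext. intros m.
  change (@mult C_Ring) with Cmult. unfold b, Cdiv.
  rewrite Rpow_C_eta_arg, RtoC_mult. unfold x. ring_C.
Qed.

(** For all but finitely many [n] the argument [s + 2 nu n] has real part at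
    least [2], where the Euler transform is bounded uniformly. *)
Lemma ex_series_a_coef_eta (kappa nu : R) (s : C) :
  3 / PI < kappa -> 0 < nu ->
  ex_series (fun n => Rabs (a_coef kappa n) *
    Series (fun k => Cmod (eta_term (eta_arg nu s n) k))).
Proof.
  intros Hk Hnu.
  assert (Hq : 0 <= Rmax 0 ((2 - Re s) / (2 * nu))) by apply Rmax_l.
  destruct (nfloor_ex _ Hq) as [p [_ Hp]].
  apply (ex_series_incr_n _ (S p)).
  apply (ex_series_le (V := R_CompleteNormedModule) _
    (fun n => 4 * Rabs (a_coef kappa (S p + n)))).
  - intros n. change (@norm R_AbsRing R_CompleteNormedModule) with Rabs.
    rewrite Rabs_mult, Rabs_Rabsolu, Rmult_comm.
    apply Rmult_le_compat_r; [apply Rabs_pos|].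
    rewrite Rabs_pos_eq.
    + apply norm_eta_term_le. rewrite Re_eta_arg.
      assert (H : (2 - Re s) / (2 * nu) <= INR (S p + n)).
      { rewrite plus_INR, S_INR. generalize (Rmax_r 0 ((2 - Re s) / (2 * nu))) (pos_INR n). lra. }
      apply Rle_div_l in H; lra.
    + apply Rle_trans with (sum_n (fun k => Cmod (eta_term (eta_arg nu s (S p + n)) k)) 0).
      * rewrite sum_O. apply Cmod_ge_0.
      * apply sum_n_le_is_series; [intros; apply Cmod_ge_0|].
        apply Series_correct, ex_series_norm_eta_term.
  - apply (ex_series_scal_l (V := R_NormedModule) 4).
    apply (ex_series_incr_n (fun n => Rabs (a_coef kappa n)) (S p)).
    destruct (is_series_a_coef kappa 1 Hk ltac:(rewrite Rabs_R1; lra)) as [_ H].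
    eapply ex_series_ext; [|exact H]. intros n. cbv beta. now rewrite pow1, Rmult_1_r.
Qed.

(* The first three conjuncts assert the convergence of the series that define
   [eta], [eta_kn] and [a_coef].  The sums over [n >= 1] are reindexed from 0. *)
Theorem theorem3p1 (kappa nu : R) (s : C)
    (hkappa : 3 / PI < kappa) (hnu : 0 < nu) :
  (forall z : C, ex_series (eta_term z)) /\
  ex_series (eta_kn_term kappa nu s) /\
  (forall n : nat, ex_series (fun i => a_term kappa n (n + 1 + i))) /\
  ex_series (fun n : nat =>
    Cmod (a_coef kappa (n + 1) * eta (s + 2 * nu * INR (n + 1)))%C) /\
  eta_kn kappa nu s =
    (eta s + CSeries (fun n : nat =>
       a_coef kappa (n + 1) * eta (s + 2 * nu * INR (n + 1))))%C.
Proof.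
  set (F := fun k n => (RtoC (a_coef kappa n) * eta_term (eta_arg nu s n) k)%C).
  set (h := fun n => Rabs (a_coef kappa n) *
    Series (fun k => Cmod (eta_term (eta_arg nu s n) k))).
  set (c := fun n => (RtoC (a_coef kappa n) * eta (eta_arg nu s n))%C).
  assert (Hh : forall n, is_series (fun k => Cmod (F k n)) (h n)).
  { intros n. apply is_series_ext with
      (fun k => scal (Rabs (a_coef kappa n)) (Cmod (eta_term (eta_arg nu s n) k))).
    - intros k. unfold F. rewrite Cmod_mult, Cmod_R. reflexivity.
    - apply (is_series_scal (V := R_NormedModule)), Series_correct, ex_series_norm_eta_term. }
  assert (Hex := ex_series_a_coef_eta kappa nu s hkappa hnu).
  assert (Hc : forall n, is_series (fun k => F k n) (c n)).
  { intros n. apply (is_series_scal (V := C_NormedModule) (RtoC (a_coef kappa n))).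
    destruct (ex_series_eta_term (eta_arg nu s n)) as [l Hl].
    unfold eta. now rewrite (CSeries_unique _ _ Hl). }
  assert (Hr : forall k, is_series (F k) (eta_kn_term kappa nu s k))
    by (intros k; now apply eta_kn_term_series).
  assert (Hcn : ex_series (fun n => Cmod (c n))).
  { apply (ex_series_le (V := R_CompleteNormedModule) _ h); [|exact Hex].
    intros n. change (@norm R_AbsRing R_CompleteNormedModule) with Rabs.
    rewrite Rabs_pos_eq by apply Cmod_ge_0.
    apply (is_series_norm_le (V := C_NormedModule) (fun k => F k n) _ (fun k => Cmod (F k n)));
      [|apply Hc|apply Hh].
    intros k. apply Rle_refl. }
  assert (HS : ex_series c).
  { apply (ex_series_le (V := C_CompleteNormedModule) _ (fun n => Cmod (c n)));
      [|exact Hcn]. intros n. apply Rle_refl. }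
  destruct (HS : exists l : C, is_series c l) as [total Htotal].
  destruct (is_series_swap (V := C_CompleteNormedModule) F h c (eta_kn_term kappa nu s)
              total Hh Hex Hc Hr Htotal) as [Hkn _].
  assert (Hshift : forall n, c (S n) =
    (RtoC (a_coef kappa (n + 1)) * eta (s + 2 * nu * INR (n + 1)))%C).
  { intros n. unfold c, eta_arg. now replace (n + 1)%nat with (S n) by lia. }
  assert (H0 : c 0%nat = eta s).
  { unfold c. rewrite a_coef_0 by assumption. rewrite Cmult_1_l. f_equal.
    unfold eta_arg. simpl. ring. }
  split; [exact ex_series_eta_term|].
  split; [now exists total|].
  split; [intros n; now apply ex_series_a_term|].
  split.
  - eapply ex_series_ext; [|exact (proj1 (ex_series_incr_1 (fun n => Cmod (c n))) Hcn)].
    intros n. cbv beta. now rewrite Hshift.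
  - unfold eta_kn. rewrite (CSeries_unique _ _ Hkn).
    rewrite (CSeries_unique _ (total - eta s)%C); [ring|].
    eapply is_series_ext; [exact Hshift|].
    apply (is_series_incr_1 (V := C_NormedModule)). rewrite H0.
    replace (plus _ _) with total; [exact Htotal|]. ring_C.
Qed.
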